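(* Let $K\ge1$, let $\check x_1,\dots,\check x_K\in\mathbb R^2$ be distinct, and let $\vec\theta=(\theta_1,\dots,\theta_K)\in\mathbb R^K$, $\vec\theta\ne0$. Assume (N1)–(N3), (K1)–(K3) with $M>\nu+1$, and (X1)–(X2). Then, as $\epsilon\to0$, $$\frac{\sum_{k}\sum_{j}\bigl|\sum_{i=1}^K\theta_i\,\mathcal H\varphi'(a_k-j+\vec\alpha_k\cdot\check x_i)\bigr|^3\,\mathbb E|\eta_{k,j}|^3}{\Bigl[\sum_{k}\sum_{j}\bigl(\sum_{i=1}^K\theta_i\,\mathcal H\varphi'(a_k-j+\vec\alpha_k\cdot\check x_i)\bigr)^2\,\mathbb E\eta_{k,j}^2\Bigr]^{3/2}}=O(\epsilon^{1/2}).$$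
   Context: Fix $\kappa>0$ and $\bar p\in\mathbb R$. For $\epsilon>0$ set $\Delta p=\epsilon$, $\Delta\alpha=\kappa\epsilon$, $\alpha_k=k\Delta\alpha$, $p_j=\bar p+j\epsilon$ ($k,j\in\mathbb Z$), and $\vec\alpha=(\cos\alpha,\sin\alpha)$. Sums over $k$ range over all $k\in\mathbb Z$ with $|\alpha_k|\le\pi$; sums over $j$ range over $\mathbb Z$. Noise: for each $\epsilon$, $\{\eta_{k,j}\}$ are independent real random variables (not necessarily identically distributed) with (N1) $\mathbb E\eta_{k,j}=0$; (N2) $\mathbb E\eta_{k,j}^2=\sigma^2(\alpha_k,p_j)\Delta\alpha$, where $\sigma$ is a fixed real function of $(\alpha,p)$, $2\pi$-periodic in $\alpha$, of class $C^1$, bounded with bounded first partial derivatives on the relevant domain; (N3) $\mathbb E|\eta_{k,j}|^3\le c(\Delta\alpha)^{3/2}$ with $c$ independent of $k,j,\epsilon$. Kernel $\varphi:\mathbb R\to\mathbb R$: (K1) compactly supported; (K2) $\varphi^{(M+1)}\in L^\infty(\mathbb R)$ for some integer $M\ge3$; (K3) $\int\varphi=1$. $\mathcal H$ is the Hilbert transform, $\mathcal Hg(t)=\frac1\pi\,\mathrm{p.v.}\!\int\frac{g(s)}{t-s}ds$. For $x_0\in\mathbb R^2$ set $a_k=(\vec\alpha_k\cdot x_0-\bar p)/\epsilon$. For $r\in\mathbb R$, $\langle r\rangle=\operatorname{dist}(r,\mathbb Z)$. An irrational $s$ is of type $\nu>0$ if for every $\nu_1>\nu$ there is $c(s,\nu_1)>0$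 with $m^{\nu_1}\langle ms\rangle\ge c(s,\nu_1)$ for all $m\in\mathbb N$. (X1) $\kappa|x_0|$ is irrational and of some finite type $\nu$; (X2) $\sigma^2(\alpha,\vec\alpha\cdot x_0)\neq0$ for all $\alpha$ in some nonempty open set $\Omega\subset[0,2\pi]$. *)

(* Defs.v *)
From HB Require Import structures.
From mathcomp Require Import all_boot all_order all_algebra.
From mathcomp Require Import all_classical all_reals all_analysis.
Set Implicit Arguments. Unset Strict Implicit. Unset Printing Implicit Defensive.
Import Order.TTheory GRing.Theory Num.Theory.
Import numFieldNormedType.Exports.
Local Open Scope classical_set_scope.
Local Open Scope ring_scope.

Section defs.
Variable R : realType.

Definition distZ (r : R) : R :=
  Num.min (r - (Num.floor r)%:~R) ((Num.ceil r)%:~R - r).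

Definition irrational (s : R) : Prop := forall q : rat, s <> ratr q.

Definition of_type (s nu : R) : Prop :=
  irrational s /\
  forall nu1 : R, nu < nu1 ->
    exists c : R, 0 < c /\
      forall m : nat, (0 < m)%N -> c <= (m%:R) `^ nu1 * distZ (m%:R * s).

Definition hilbert (g : R -> R) (t : R) : R :=
  pi^-1 * lim ((fun d : R =>
     Rintegral lebesgue_measure [set s : R | d < `|t - s|] (fun s => g s / (t - s)))
     @ (0:R)^'+).

Definition dir_dot (a : R) (x : R * R) : R := cos a * x.1 + sin a * x.2.

Definition partial1 (f : R -> R -> R) (a p : R) : R := derive1 (fun a' => f a' p) a.
Definition partial2 (f : R -> R -> R) (a p : R) : R := derive1 (fun p' => f a p') p.

End defs.

Definition mutual_indep {d} {T : measurableType d} {R : realType}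
  (P : probability T R) {I : eqType} (A : set I) (X : I -> T -> R) : Prop :=
  forall (s : seq I) (B : I -> set R), uniq s -> (forall i, i \in s -> A i) ->
    (forall i, measurable (B i)) ->
    P (\bigcap_(i in [set i | i \in s]) (X i @^-1` B i)) =
    (\prod_(i <- s) P (X i @^-1` B i))%E.

Local Open Scope ring_scope.
Section defs2.
Variable R : realType.

Definition krange (kappa e : R) : set int :=
  [set k : int | `|k%:~R * (kappa * e)| <= pi].

Definition alpha_k (kappa e : R) (k : int) : R := k%:~R * (kappa * e).
Definition p_j (pbar e : R) (j : int) : R := pbar + j%:~R * e.
Definition a_k (kappa pbar e : R) (x0 : R * R) (k : int) : R :=
  (dir_dot (alpha_k kappa e k) x0 - pbar) / e.

Definition Hsum (K : nat) (xs : 'I_K -> R * R) (theta : 'I_K -> R) (phi : R -> R)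
  (kappa pbar e : R) (x0 : R * R) (k j : int) : R :=
  \sum_(i < K) theta i * hilbert (derive1 phi)
      (a_k kappa pbar e x0 k - j%:~R + dir_dot (alpha_k kappa e k) (xs i)).

Definition norm2 (x : R * R) : R := Num.sqrt (x.1 ^+ 2 + x.2 ^+ 2).
End defs2.

(* Main.v *)
Require Import Defs.
From HB Require Import structures.
From mathcomp Require Import all_boot all_order all_algebra.
From mathcomp Require Import all_classical all_reals all_analysis.
From mathcomp Require Import measurable_realfun ring lra zify.
Import Order.TTheory GRing.Theory Num.Theory.
Import numFieldNormedType.Exports.
Local Open Scope classical_set_scope.
Local Open Scope ereal_scope.
Local Open Scope ring_scope.
Set Implicit Arguments. Unset Strict Implicit. Unset Printing Implicit Defensive.

(* With Delta alpha = kappa eps there are O(1/eps) indices k, the kernel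
   h = H phi' is O(1/(2+|t|)), so each inner sum over j is bounded and the
   numerator is O(eps^(-1) eps^(3/2)) = O(eps^(1/2)).  It remains to bound the
   denominator below.  Fix an angle alpha0 in Omega (up to 2 pi) at which the numbers
   b_i = alpha0 . x_i are distinct.  By Vandermonde some power sum
   sum_i theta_i (-b_i)^N is nonzero; for the least such N, since int phi' = 0 and
   int s phi'(s) ds = -1, the function t^(N+2) sum_i theta_i h(t + b_i) has a nonzero
   limit at infinity.  Hence sum_i theta_i h(t + alpha . x_i) stays away from 0 for t
   in some interval [T0, T0 + 1] and alpha near alpha0.  For each of the ~ 1/eps
   indices k with alpha_k near alpha0, that interval contains some a_k - j, where
   p_j is within O(eps) of alpha_k . x0 and sigma^2 is bounded below. *)

(** * Power sums and lattice sums *)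

(** If every power sum vanished, [theta] would lie in the kernel of the Vandermonde matrix of the
    distinct nodes [b i], which is invertible. *)
Lemma exists_power_sum_neq0 (F : fieldType) (K : nat) (theta b : 'I_K -> F) :
  injective b -> (exists i, theta i != 0) ->
  exists n, \sum_i theta i * b i ^+ n != 0.
Proof.
move=> injb [i0 th0]; apply: contrapT => nex.
have sum0 n : \sum_i theta i * b i ^+ n = 0.
  by apply/eqP; apply: contraT => ?; case: nex; exists n.
pose V := Vandermonde K (\row_i b i).
have Vunit : V \in unitmx.
  rewrite unitmxE det_Vandermonde unitfE; apply/prodf_neq0 => i _.
  apply/prodf_neq0 => j ij; rewrite !mxE subr_eq0.
  by apply: contraTneq ij => /injb ->; rewrite ltnn.
have V0 : V *m (\col_i theta i) = 0.
  apply/matrixP => n k; rewrite !mxE -[RHS](sum0 n).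
  by apply: eq_bigr => i _; rewrite !mxE mulrC.
have := mulKmx Vunit (\col_i theta i); rewrite V0 mulmx0 => /matrixP/(_ i0 0).
by rewrite !mxE => e; rewrite -e eqxx in th0.
Qed.

(** This is the factorization of [t ^+ m - u ^+ m] by [t - u]. It expands the Cauchy kernel in
    powers of [u] with an exact remainder, so no convergence of series is involved. *)
Lemma geometric_inv_sub (F : fieldType) (t u : F) (m : nat) : t - u != 0 ->
  t ^+ m / (t - u) = \sum_(n < m) t ^+ (m.-1 - n) * u ^+ n + u ^+ m / (t - u).
Proof.
move=> tu; apply: (mulIf tu).
rewrite mulrDl !divfK// mulrC -subrXX subrK//.
Qed.

Section translated_power_sums.
Variables (F : comNzRingType) (K : nat) (theta c : 'I_K -> F) (N : nat).
Let B n := \sum_i theta i * c i ^+ n.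
Let q n s := \sum_i theta i * (s + c i) ^+ n.
Hypothesis B0 : forall n, (n < N)%N -> B n = 0.

(** Binomial expansion in [s] with the power sums as coefficients. Once the first [N] of them
    vanish, [q n] is zero below rank [N], constant at [N] and affine at [N.+1], as the next three
    lemmas record. *)
Lemma translated_power_sumE n s :
  q n s = \sum_(l < n.+1) (s ^+ (n - l) * B l) *+ 'C(n, l).
Proof.
rewrite /q; under eq_bigr do rewrite exprDn mulr_sumr.
rewrite exchange_big; apply: eq_bigr => l _ /=.
rewrite mulr_sumr -sumrMnl; apply: eq_bigr => i _.
by rewrite mulrnAr mulrCA.
Qed.

Lemma translated_power_sum_lt n s : (n < N)%N -> q n s = 0.
Proof.
move=> nN; rewrite translated_power_sumE big1// => l _.
by rewrite B0 ?mulr0 ?mul0rn// (leq_ltn_trans _ nN)// -ltnS.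
Qed.

Lemma translated_power_sum_min s : q N s = B N.
Proof.
rewrite translated_power_sumE big_ord_recr /= subnn expr0 mul1r binn mulr1n.
by rewrite big1 ?add0r// => l _; rewrite B0// mulr0 mul0rn.
Qed.

Lemma translated_power_sum_minS s :
  q N.+1 s = N.+1%:R * B N * s + B N.+1.
Proof.
rewrite translated_power_sumE !big_ord_recr /= subnn expr0 mul1r binn mulr1n.
rewrite big1 ?add0r//; last by move=> l _; rewrite B0// mulr0 mul0rn.
rewrite subSnn expr1 binSn -mulr_natl; congr (_ + _).
by rewrite [s * _]mulrC mulrA.
Qed.

End translated_power_sums.

(** Each [Q i] holds at one point of the interval at most, so it fails throughout one of the two
    open halves. The induction continues in that half. *)
Lemma avoid_finitely_many (R : realFieldType) (I : Type) (Q : I -> R -> Prop)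
    (s : seq I) (a b : R) : a < b ->
  (forall i x y, a < x < b -> a < y < b -> Q i x -> Q i y -> x = y) ->
  exists2 x, a < x < b & forall i, List.In i s -> ~ Q i x.
Proof.
elim: s a b => [|i s IH] a b ab Qinj.
  by exists ((a + b) / 2) => //; rewrite midf_lt//= midf_lt.
have [am mb] := midf_lt ab; set m := (a + b) / 2 in am mb.
have [[x [/andP[ax xm] Qx]]|nQ] :=
    pselect (exists x, a < x < m /\ Q i x).
- have [|y /andP[my yb] sy] := IH m b mb.
    move=> j u v /andP[mu ub] /andP[mv vb].
    by apply: Qinj; rewrite ?ub ?vb ?(lt_trans am).
  exists y; first by rewrite (lt_trans am).
  move=> j [<-{j}|/sy//] Qy.
  have xy : x = y.
    by apply: (Qinj i) => //; rewrite ?ax ?(lt_trans xm)// yb (lt_trans am).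
  by have := lt_trans xm my; rewrite xy ltxx.
- have [|y /andP[ay ym] sy] := IH a m am.
    move=> j u v /andP[au um] /andP[av vm].
    by apply: Qinj; rewrite ?au ?av (lt_trans _ mb).
  exists y; first by rewrite ay (lt_trans ym).
  by move=> j [<-{j}|/sy//] Qy; apply: nQ; exists y; rewrite ay ym.
Qed.

Lemma avoid_finType (R : realFieldType) (I : finType) (Q : I -> R -> Prop)
    (a b : R) : a < b ->
  (forall i x y, a < x < b -> a < y < b -> Q i x -> Q i y -> x = y) ->
  exists2 x, a < x < b & forall i, ~ Q i x.
Proof.
move=> ab /(avoid_finitely_many (enum I) ab)[x axb sx]; exists x => // i.
apply: sx; have : i \in enum I by rewrite mem_enum.
by elim: (enum I) => //= j l IH; rewrite inE => /orP[/eqP->|/IH]; [left|right].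
Qed.

Lemma ler_sum_sub_seq (R : numDomainType) (I : eqType) (s t : seq I) (f : I -> R) :
  uniq s -> {subset s <= t} -> (forall i, 0 <= f i) ->
  \sum_(i <- s) f i <= \sum_(i <- t) f i.
Proof.
move=> us st f0.
have -> : \sum_(i <- s) f i = \sum_(i <- undup t | i \in s) f i.
  rewrite -[RHS]big_filter; apply: perm_big; apply: uniq_perm => //.
    by rewrite filter_uniq// undup_uniq.
  by move=> i; rewrite mem_filter mem_undup; case: (boolP (i \in s)) => // /st ->.
apply: (@le_trans _ _ (\sum_(i <- undup t) f i)).
  by rewrite [leRHS](bigID (mem s)) /= lerDl sumr_ge0.
elim: t {st} => //= i t IH; rewrite [leRHS]big_cons; case: ifP => _.
  by rewrite (le_trans IH)// lerDr.
by rewrite big_cons lerD2l.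
Qed.

Definition int_range (n : nat) : seq int :=
  [seq i%:Z - n%:Z | i <- iota 0 n.*2.+1].

Lemma mem_int_range n j : (`|j|%N <= n)%N -> j \in int_range n.
Proof.
move=> jn; apply/mapP; exists `|(j + n%:Z)%R|%N; last by lia.
by rewrite mem_iota; lia.
Qed.

Lemma int_seq_bounded (s : seq int) : exists n, {subset s <= int_range n}.
Proof.
suff [n sn] : exists n, forall j, j \in s -> (`|j|%N <= n)%N.
  by exists n => j /sn; exact: mem_int_range.
elim: s => [|i s [n IH]]; first by exists 0%N.
exists (maxn `|i|%N n) => j; rewrite inE => /orP[/eqP->|/IH jn].
  by rewrite leq_maxl.
by rewrite leq_max jn orbT.
Qed.

(** * A bound for inverse-square sums over the integers, uniform in the shift *)

Section lattice_sum.
Variable R : realType.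

(** The increments of the bounded function [x / (1 + |x|)] over unit steps dominate the summand,
    which makes lattice sums telescope. The cases are the sign patterns of [x] and [x + 1]. *)
Lemma inv_sqr_telescope (x : R) :
  (2 + `|x|) ^- 2 <= (x + 1) / (1 + `|x + 1|) - x / (1 + `|x|).
Proof.
have key (u v w : R) : 0 < u -> 0 < v -> 0 < w -> u <= w -> v <= w ->
    w ^- 2 <= (u * v)^-1.
  move=> u0 v0 w0 uw vw; rewrite lef_pV2 ?posrE ?mulr_gt0 ?exprn_gt0//.
  by rewrite expr2 ler_pM// ltW.
have [x0|x0] := leP 0 x.
  rewrite !ger0_norm ?addr_ge0//.
  have -> : (x + 1) / (1 + (x + 1)) - x / (1 + x) = ((1 + (x + 1)) * (1 + x))^-1.
    by field; rewrite !gt_eqF//; lra.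
  by apply: key; lra.
have [x1|x1] := leP 0 (x + 1).
  rewrite (ger0_norm x1) (ltr0_norm x0).
  have -> : (x + 1) / (1 + (x + 1)) - x / (1 - x) =
      (1 - 2 * x * (x + 1)) * ((1 + (x + 1)) * (1 - x))^-1.
    by field; rewrite !gt_eqF//; lra.
  have /le_trans-> // : (2 - x) ^- 2 <= ((1 + (x + 1)) * (1 - x))^-1.
    by apply: key; lra.
  rewrite ler_peMl//; first by rewrite invr_ge0 mulr_ge0//; lra.
  by nra.
rewrite !ltr0_norm//.
have -> : (x + 1) / (1 - (x + 1)) - x / (1 - x) = ((1 - (x + 1)) * (1 - x))^-1.
  by field; rewrite !gt_eqF//; lra.
by apply: key; lra.
Qed.

Lemma lattice_sum_inv_sqr_le2 (s : seq int) (a : R) : uniq s ->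
  \sum_(j <- s) (2 + `|a - j%:~R|) ^- 2 <= 2.
Proof.
move=> us; have [n sn] := int_seq_bounded s.
have f0 (j : int) : 0 <= (2 + `|a - j%:~R|) ^- 2.
  by rewrite invr_ge0 exprn_ge0// addr_ge0.
apply: le_trans (ler_sum_sub_seq us sn f0) _.
(* [G] takes values in [-1, 1], so the telescoped sum is at most 2, whatever the shift and the
   number of terms. *)
pose G (y : R) := y / (1 + `|y|).
pose x0 := - n%:R - a.
have -> : \sum_(j <- int_range n) (2 + `|a - j%:~R|) ^- 2 =
          \sum_(0 <= i < n.*2.+1) (2 + `|x0 + i%:R|) ^- 2.
  rewrite big_map /index_iota subn0; apply: eq_bigr => i _; congr ((2 + _) ^- 2).
  rewrite -normrN; congr (`| _ |); rewrite /x0 rmorphB/=.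
  by rewrite -!pmulrn; ring.
apply: (@le_trans _ _ (\sum_(0 <= i < n.*2.+1) (G (x0 + i.+1%:R) - G (x0 + i%:R)))).
  by apply: ler_sum => i _; rewrite -[i.+1%:R]natr1 addrA; exact: inv_sqr_telescope.
rewrite (telescope_sumr (fun i => G (x0 + i%:R)))//.
have G1 y : `|G y| <= 1.
  rewrite /G normrM normfV (ger0_norm (_ : 0 <= 1 + `|y|)) ?addr_ge0//.
  by rewrite ler_pdivrMr ?mul1r ?lerDr// ltr_pwDl.
have /ler_normlP[_ h1] := G1 (x0 + n.*2.+1%:R).
have /ler_normlP[h2 _] := G1 (x0 + 0%:R).
by lra.
Qed.

End lattice_sum.

Section esum_bounds.
Variable R : realType.

Lemma esum_le_seq (T : choiceType) (D : set T) (f : T -> R) (C : R) :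
  (forall s : seq T, uniq s -> (forall x, x \in s -> D x) -> \sum_(x <- s) f x <= C) ->
  (\esum_(x in D) (f x)%:E <= C%:E)%E.
Proof.
move=> fC; apply: ge_ereal_sup => _ [X [finX XD] <-].
rewrite fsbig_finite//= sumEFin lee_fin; apply: fC; first exact: finmap.fset_uniq.
by move=> x; rewrite in_fset_set// inE => /XD.
Qed.

Lemma le_esum_seq (T : choiceType) (D : set T) (f : T -> \bar R) (C : R) (s : seq T) :
  uniq s -> (forall x, x \in s -> D x) -> (C%:E <= \sum_(x <- s) f x)%E ->
  (C%:E <= \esum_(x in D) f x)%E.
Proof.
move=> us sD Cs; apply: esum_ge; exists [set` s].
  by split; [exact: finite_seq|move=> x /= /sD].
apply: le_trans Cs _.
rewrite fsbig_finite ?finite_seq//= le_eqVlt; apply/orP; left; apply/eqP.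
apply: perm_big; apply: uniq_perm; rewrite ?finmap.fset_uniq// => x.
by rewrite in_fset_set ?finite_seq// mem_setE.
Qed.

End esum_bounds.

(** * Hilbert transform of a compactly supported Lipschitz function *)

Section bounded_integrals.
Variable R : realType.
Notation mu := (@lebesgue_measure R).

Lemma bounded_integrable (D : set R) (f : R -> R) (a b C : R) :
  measurable D -> D `<=` `[a, b] -> measurable_fun D f ->
  (forall x, D x -> `|f x| <= C) -> mu.-integrable D (EFin \o f).
Proof.
move=> mD Dab mf fC; apply: measurable_bounded_integrable => //.
  apply: (@le_lt_trans _ _ (mu `[a, b])); first by apply: le_measure; rewrite ?inE.
  by rewrite lebesgue_measure_itv/=; case: ifP => _; rewrite ?ltry// -EFinB ltry.
exists C; split; first by rewrite num_real.
by move=> y Cy x Dx /=; rewrite (le_trans (fC _ Dx))// ltW.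
Qed.

Lemma normr_Rintegral_le (D : set R) (f : R -> R) (a b C : R) :
  measurable D -> D `<=` `[a, b] -> a <= b -> measurable_fun D f ->
  0 <= C -> (forall x, D x -> `|f x| <= C) ->
  `|Rintegral mu D f| <= C * (b - a).
Proof.
move=> mD Dab ab mf C0 fC.
have intf := bounded_integrable mD Dab mf fC.
have muD : (mu D <= (b - a)%:E)%E.
  apply: (@le_trans _ _ (mu `[a, b])); first by apply: le_measure; rewrite ?inE.
  rewrite lebesgue_measure_itv/= lte_fin; case: ifP => _; first by rewrite -EFinB.
  by rewrite lee_fin subr_ge0.
have fmuD : mu D \is a fin_num.
  by rewrite ge0_fin_numE// (le_lt_trans muD)// ltry.
apply: (le_trans (le_normr_Rintegral _ intf)) => //.
apply: (@le_trans _ _ (Rintegral mu D (fun=> C))).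
  apply: le_Rintegral => //.
  - apply: (bounded_integrable mD Dab (C := C)); first exact: measurableT_comp.
    by move=> x Dx; rewrite normr_id fC.
  - apply: (bounded_integrable mD Dab (C := C)) => // x Dx.
    by rewrite ger0_norm.
rewrite Rintegral_cst// ler_wpM2l// -lee_fin fineK//.
Qed.

Lemma measurable_fun_continuous_in (D : set R) (f : R -> R) : measurable D ->
  (forall x, D x -> {for x, continuous f}) -> measurable_fun D f.
Proof.
move=> mD cf; apply: subspace_continuous_measurable_fun => //.
by apply: continuous_in_subspaceT => x; rewrite inE => /cf.
Qed.

Lemma Rintegral_FTC2 (f F : R -> R) (a b : R) : a < b ->
  (forall x, a <= x <= b -> {for x, continuous f}) ->
  (forall x, a <= x <= b -> is_derive x 1 F (f x)) ->
  Rintegral mu `[a, b] f = F b - F a.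
Proof.
move=> ab cf dF.
have cF x : a <= x <= b -> {for x, continuous F}.
  by move=> /dF [/derivable1_diffP/differentiable_continuous].
rewrite /Rintegral (continuous_FTC2 (F := F) ab)//.
- by apply: continuous_in_subspaceT => x; rewrite inE/= in_itv/=; exact: cf.
- split.
  + by move=> x; rewrite in_itv/= => /andP[ax xb]; have [] := dF x; rewrite ?(ltW ax) ?(ltW xb).
  + by apply: cvg_at_right_filter; apply: cF; rewrite lexx ltW.
  + by apply: cvg_at_left_filter; apply: cF; rewrite lexx ltW.
- move=> x; rewrite in_itv/= => /andP[ax xb].
  by rewrite derive1E; have -> := @derive_val _ _ _ _ _ _ _ (dF x _); rewrite // (ltW ax) ltW.
Qed.

End bounded_integrals.

Section hilbert_transform.
Variables (R : realType) (g : R -> R) (A G Lg : R).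
Notation mu := (@lebesgue_measure R).
Hypothesis A0 : 0 < A.
Hypothesis cg : continuous g.
Hypothesis gsupp : forall x, A < `|x| -> g x = 0.
Hypothesis gbnd : forall x, `|g x| <= G.
Hypothesis glip : forall x y, `|g x - g y| <= Lg * `|x - y|.

Let I (t : R) := Rintegral mu `[- A, A] (fun s => g s / (t - s)).

Let G0 : 0 <= G. Proof. exact: le_trans (normr_ge0 _) (gbnd 0). Qed.

Let Lg0 : 0 <= Lg.
Proof. by have := le_trans (normr_ge0 _) (glip 1 0); rewrite subr0 normr1 mulr1. Qed.

Lemma continuous_inv_sub (t s : R) : t != s ->
  {for s, continuous (fun s => (t - s)^-1)}.
Proof.
move=> ts; apply: cvgV; first by rewrite subr_eq0.
by apply: cvgB; [exact: cvg_cst|exact: cvg_id].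
Qed.

Lemma continuous_div_sub (f : R -> R) (t s : R) : {for s, continuous f} -> t != s ->
  {for s, continuous (fun s => f s / (t - s))}.
Proof. by move=> cf ts; apply: cvgM => //; exact: continuous_inv_sub. Qed.

(** Away from the support there is no singularity: as soon as [d < |t| - A], the truncation removes
    no point of [[- A, A]], so the truncated integrals are eventually constant. *)
Lemma hilbert_far (t : R) : A < `|t| -> hilbert g t = pi^-1 * I t.
Proof.
move=> At; rewrite /hilbert; congr (_ * _); apply: lim_near_cst => //.
near=> d.
rewrite /I Rintegral_mkcond [RHS]Rintegral_mkcond; apply: eq_Rintegral => s _.
rewrite /patch.
have [sA|sA] := leP `|s| A; last first.
  by rewrite gsupp// mul0r; case: ifP; case: ifP.
rewrite ifT; last first.
  rewrite inE/=; apply: (@lt_le_trans _ _ (`|t| - A)).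
    by near: d; apply: nbhs_right_lt; rewrite subr_gt0.
  by rewrite (le_trans _ (lerB_dist _ _))// lerB.
by rewrite ifT// inE/= in_itv/= -ler_norml.
Unshelve. all: by end_near. Qed.


(* Subtracting [g t] from the numerator is free because of this cancellation. *)
Lemma Rintegral_inv_sub_punctured (t d r : R) : 0 < d -> d < r ->
  Rintegral mu (`[t - r, t - d[ `|` `]t + d, t + r]) (fun s => (t - s)^-1) = 0.
Proof.
move=> d0 dr.
have away (s : R) : (`[t - r, t - d] `|` `[t + d, t + r]) s -> d <= `|t - s|.
  rewrite /= !in_itv/= => -[|] /andP[h1 h2]; first by rewrite ger0_norm; lra.
  by rewrite ler0_norm; lra.
have neq (s : R) : (`[t - r, t - d] `|` `[t + d, t + r]) s -> t != s.
  by move=> /away; apply: contraTneq => ->; rewrite subrr normr0 -ltNge.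
have inte (D : set R) : measurable D -> D `<=` `[t - r, t - d] `|` `[t + d, t + r] ->
    mu.-integrable D (EFin \o (fun s => (t - s)^-1)).
  move=> mD sD; apply: (bounded_integrable (a := t - r) (b := t + r) (C := d^-1)) => //.
  - by move=> s /sD; rewrite /= !in_itv/= => -[|] /andP[h1 h2]; lra.
  - by apply: measurable_fun_continuous_in => // s /sD/neq; apply: continuous_inv_sub.
  - move=> s /sD/away ds; rewrite normfV lef_pV2// posrE//.
    exact: lt_le_trans ds.
have sub1 : `[t - r, t - d[ `<=` `[t - r, t - d] `|` `[t + d, t + r].
  by move=> s /=; rewrite !in_itv/= => /andP[-> /ltW ->]; left.
have sub2 : `]t + d, t + r] `<=` `[t - r, t - d] `|` `[t + d, t + r].
  by move=> s /=; rewrite !in_itv/= => /andP[/ltW -> ->]; right.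
rewrite Rintegral_setU//; last 2 first.
- by apply: inte; [exact: measurableU|rewrite subUset].
- by apply/disj_setPS => s [] /=; rewrite !in_itv/= => /andP[_ h1] /andP[h2 _]; lra.
rewrite Rintegral_itv_bndo_bndc; last by apply: inte.
rewrite Rintegral_itv_obnd_cbnd; last by apply: inte.
(* The antiderivative is [- ln |t - s|] on both sides of [t]; the two halves contribute opposite
   values. *)
have -> : Rintegral mu `[t - r, t - d] (fun s => (t - s)^-1) = ln r - ln d.
  rewrite (_ : ln r - ln d = - ln (t - (t - d)) - - ln (t - (t - r))); last first.
    by rewrite opprK addrC !subKr.
  apply: (@Rintegral_FTC2 _ _ (fun s => - ln (t - s))); first by lra.
  - by move=> s srd; apply: continuous_inv_sub; apply: neq; left; rewrite /= in_itv.
  - move=> s srd; have st : 0 < t - s by lra.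
    have dts : is_derive s 1 (fun s => t - s) (-1).
      by have := is_deriveB (is_derive_cst t s 1) (is_derive_id s 1); rewrite sub0r.
    have := is_deriveN (@is_derive1_comp _ (@ln R) (fun s => t - s) s _ _ (is_derive1_ln st) dts).
    by rewrite mulrN1 opprK.
have -> : Rintegral mu `[t + d, t + r] (fun s => (t - s)^-1) = ln d - ln r.
  rewrite (_ : ln d - ln r = - ln (t + r - t) - - ln (t + d - t)); last first.
    by rewrite opprK addrC ![t + _]addrC !addrK.
  apply: (@Rintegral_FTC2 _ _ (fun s => - ln (s - t))); first by lra.
  - by move=> s srd; apply: continuous_inv_sub; apply: neq; right; rewrite /= in_itv.
  - move=> s srd; have st : 0 < s - t by lra.
    have dts : is_derive s 1 (fun s => s - t) 1.
      by have := is_deriveB (is_derive_id s 1) (is_derive_cst t s 1); rewrite subr0.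
    have := is_deriveN (@is_derive1_comp _ (@ln R) (fun s => s - t) s _ _ (is_derive1_ln st) dts).
    by rewrite mulr1 -invrN opprB.
by rewrite addrC subrKA subrr.
Qed.

(** The window of radius [2 * A + 2] centred at [t] contains the support and is symmetric about [t],
    so [g s] may be replaced by [g s - g t]. The difference quotient is then at most [Lg], which
    gives a bound independent of [d]. *)
Lemma truncated_hilbert_near (t d : R) : `|t| <= A + 1 -> 0 < d -> d < 2 * A + 2 ->
  `|Rintegral mu [set s | d < `|t - s|] (fun s => g s / (t - s))|
  <= Lg * (2 * (2 * A + 2)).
Proof.
have A_gt0 := A0.
move=> tA d0; set r := 2 * A + 2 => dr.
set E := `[t - r, t - d[ `|` `]t + d, t + r].
have mE : measurable E by exact: measurableU.
have Er : E `<=` `[t - r, t + r].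
  by move=> s; rewrite /E /= !in_itv/= => -[|] /andP[h1 h2]; lra.
have away (s : R) : E s -> d <= `|t - s|.
  rewrite /E /= !in_itv/= => -[|] /andP[h1 h2]; first by rewrite ger0_norm; lra.
  by rewrite ler0_norm; lra.
have neq (s : R) : E s -> t != s.
  by move=> /away; apply: contraTneq => ->; rewrite subrr normr0 -ltNge.
have -> : Rintegral mu [set s | d < `|t - s|] (fun s => g s / (t - s)) =
          Rintegral mu E (fun s => (g s - g t) / (t - s) + g t * (t - s)^-1).
  rewrite Rintegral_mkcond [RHS]Rintegral_mkcond; apply: eq_Rintegral => s _.
  rewrite /patch -mulrDl subrK.
  have [sA|sA] := leP `|s| A; last by rewrite gsupp// mul0r; case: ifP; case: ifP.
  suff -> : (s \in [set s | d < `|t - s|]) = (s \in E) by [].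
  apply/idP/idP; rewrite !inE /E /= !in_itv/=.
    move: sA tA; rewrite !ler_norml => /andP[s1 s2] /andP[t1 t2].
    rewrite ltr_normr => /orP[h|h]; [left|right]; apply/andP; split; rewrite /r; lra.
  rewrite ltr_normr => -[|] /andP[h1 h2]; apply/orP; [left|right]; lra.
have kL (s : R) : E s -> `|(g s - g t) / (t - s)| <= Lg.
  move=> Es; rewrite normrM normfV ler_pdivrMr.
    by rewrite (distrC t); exact: glip.
  by rewrite (lt_le_trans d0)// away.
have mk : measurable_fun E (fun s => (g s - g t) / (t - s)).
  apply: measurable_fun_continuous_in => // s /neq ts.
  apply: (@continuous_div_sub (fun s => g s - g t)) => //.
  by apply: cvgB; [exact: cg|exact: cvg_cst].
have mi : measurable_fun E (fun s => (t - s)^-1).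
  apply: measurable_fun_continuous_in => // s /neq.
  exact: continuous_inv_sub.
have ib (s : R) : E s -> `|(t - s)^-1| <= d^-1.
  by move=> /away ds; rewrite normfV lef_pV2// posrE// (lt_le_trans _ ds).
have ii := bounded_integrable mE Er mi ib.
rewrite RintegralD//; last 2 first.
- exact: (bounded_integrable mE Er mk kL).
- apply: (bounded_integrable mE Er (C := G * d^-1)).
    by apply: measurable_funM => //; exact: measurable_cst.
  by move=> s Es; rewrite normrM ler_pM// ?gbnd ?ib.
rewrite RintegralZl// Rintegral_inv_sub_punctured// mulr0 addr0.
have -> : 2 * r = (t + r) - (t - r) by ring.
have trr : t - r <= t + r by rewrite lerD2l /r; lra.
by apply: (normr_Rintegral_le mE Er) => //; apply: Lg0.
Qed.

(* [point] accounts for the junk value of [lim] in case the principal value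
   did not converge; its convergence is never needed. *)
Lemma hilbert_near (t : R) : `|t| <= A + 1 ->
  `|hilbert g t| <= pi^-1 * (Lg * (2 * (2 * A + 2)) + `|point : R|).
Proof.
have A_gt0 := A0.
move=> tA; rewrite /hilbert normrM ger0_norm ?invr_ge0 ?pi_ge0//.
rewrite ler_wpM2l// ?invr_ge0 ?pi_ge0//.
set F := (X in lim X).
have [cF|/dvgP ->] := pselect (cvg F); last first.
  by rewrite lerDr mulr_ge0// mulr_ge0//; lra.
apply: (@le_trans _ _ (Lg * (2 * (2 * A + 2)))); last by rewrite lerDl.
have ev : \forall d \near (0:R)^'+, 0 < d < 2 * A + 2.
  near=> d; apply/andP; split; near: d; first exact: nbhs_right_gt.
  by apply: nbhs_right_lt; lra.
rewrite ler_norml; apply/andP; split.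
- apply: limr_ge => //; apply: filterS ev => d /andP[d0 dr].
  by have /ler_normlP[h _] := truncated_hilbert_near tA d0 dr; lra.
- apply: limr_le => //; apply: filterS ev => d /andP[d0 dr].
  by have /ler_normlP[_ h] := truncated_hilbert_near tA d0 dr.
Unshelve. all: by end_near. Qed.

Lemma hilbert_far_le (t : R) : A < `|t| ->
  `|hilbert g t| <= pi^-1 * (G / (`|t| - A) * (2 * A)).
Proof.
have A_gt0 := A0.
move=> At; rewrite hilbert_far// normrM ger0_norm ?invr_ge0 ?pi_ge0//.
rewrite ler_wpM2l// ?invr_ge0 ?pi_ge0//.
have tA (s : R) : `[- A, A]%classic s -> `|t| - A <= `|t - s|.
  rewrite /= in_itv/= -ler_norml => sA.
  by rewrite (le_trans _ (lerB_dist _ _))// lerB.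
have neq (s : R) : `[- A, A]%classic s -> t != s.
  by move=> /tA h; apply/eqP => ts; move: h; rewrite -ts subrr normr0 leNgt subr_gt0 At.
have -> : 2 * A = A - (- A) by ring.
apply: normr_Rintegral_le => //.
- by lra.
- apply: measurable_fun_continuous_in => // s /neq ts.
  by apply: continuous_div_sub => //; exact: cg.
- by rewrite divr_ge0// subr_ge0 ltW.
- move=> s /tA ts; rewrite normrM normfV ler_pM ?invr_ge0 ?gbnd//.
  have t0 : 0 < `|t| - A by rewrite subr_gt0.
  by rewrite lef_pV2// posrE// (lt_le_trans t0).
Qed.

Lemma hilbert_decay : exists C, 0 <= C /\ forall t, `|hilbert g t| <= C / (2 + `|t|).
Proof.
have A_gt0 := A0.
pose C1 := pi^-1 * (Lg * (2 * (2 * A + 2)) + `|point : R|).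
pose C2 := pi^-1 * (G * (2 * A)).
have pi1 : 0 <= pi^-1 :> R by rewrite invr_ge0 pi_ge0.
have C10 : 0 <= C1.
  by rewrite mulr_ge0// addr_ge0// mulr_ge0// mulr_ge0//; lra.
have C20 : 0 <= C2 by rewrite mulr_ge0// mulr_ge0//; lra.
(* For [|t| <= A + 1] one has [2 + |t| <= 3 + A]; beyond, [|t| - A >= 1] gives
   [2 + |t| <= (3 + A) * (|t| - A)]. Hence the factor [3 + A] in both regimes. *)
exists (C1 * (3 + A) + C2 * (3 + A)); split; first by rewrite addr_ge0// mulr_ge0//; lra.
move=> t; have t2 : 0 < 2 + `|t| by have := normr_ge0 t; lra.
have [tA|tA] := leP `|t| (A + 1).
  rewrite ler_pdivlMr//; apply: (@le_trans _ _ (C1 * (3 + A))).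
    by rewrite ler_pM ?hilbert_near//; lra.
  by rewrite lerDl mulr_ge0//; lra.
have tA' : A < `|t| by lra.
apply: le_trans (hilbert_far_le tA') _.
have -> : pi^-1 * (G / (`|t| - A) * (2 * A)) = C2 / (`|t| - A).
  by rewrite /C2; ring.
apply: (@le_trans _ _ (C2 * (3 + A) / (2 + `|t|))); last first.
  by rewrite ler_wpM2r ?invr_ge0 ?(ltW t2)// lerDr mulr_ge0//; lra.
rewrite -mulrA ler_wpM2l// ler_pdivlMr// mulrC ler_pdivrMr ?subr_gt0//.
by nra.
Qed.

Lemma hilbert_far_lipschitz (t t' : R) : A + 1 <= t -> A + 1 <= t' ->
  `|hilbert g t - hilbert g t'| <= pi^-1 * (G * (2 * A)) * `|t - t'|.
Proof.
have A_gt0 := A0.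
move=> At At'.
have far u : A + 1 <= u -> A < `|u| by move=> Au; rewrite ger0_norm; lra.
rewrite !hilbert_far ?far//.
rewrite -mulrBr normrM ger0_norm ?invr_ge0 ?pi_ge0//.
rewrite -mulrA ler_wpM2l// ?invr_ge0 ?pi_ge0//.
have neq (u s : R) : A + 1 <= u -> `[- A, A]%classic s -> 1 <= u - s.
  by rewrite /= in_itv/= => h /andP[h1 h2]; lra.
have mu_ u : A + 1 <= u -> measurable_fun `[- A, A] (fun s => g s / (u - s)).
  move=> Au; apply: measurable_fun_continuous_in => // s /(neq _ _ Au) us.
  by apply: continuous_div_sub; [exact: cg|rewrite gt_eqF//; lra].
have iu u : A + 1 <= u -> mu.-integrable `[- A, A] (EFin \o (fun s => g s / (u - s))).
  move=> Au; apply: (bounded_integrable (a := - A) (b := A) (C := G)) => //.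
    exact: mu_.
  move=> s /(neq _ _ Au) us; rewrite normrM normfV (ger0_norm (_ : 0 <= u - s)); last by lra.
  rewrite ler_pdivrMr; last by lra.
  by rewrite (le_trans (gbnd s))// ler_peMr//; exact: G0.
rewrite -RintegralB//; [|exact: iu|exact: iu].
have -> : G * (2 * A) * `|t - t'| = (G * `|t - t'|) * (A - (- A)) by ring.
apply: normr_Rintegral_le => //.
- by lra.
- by apply: measurable_funB; exact: mu_.
- by rewrite mulr_ge0.
- move=> s sA; have := neq _ _ At sA; have := neq _ _ At' sA => h1 h2.
  (* Both factors of the denominator are at least 1, since [t] and [t'] lie at distance at least 1
     to the right of the support. *)
  have -> : g s / (t - s) - g s / (t' - s) = g s * ((t' - t) / ((t - s) * (t' - s))).
    by field; rewrite !gt_eqF//; lra.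
  have h3 : 1 <= (t - s) * (t' - s) by rewrite mulr_ege1.
  have h30 : 0 < (t - s) * (t' - s) by rewrite (lt_le_trans ltr01).
  rewrite normrM ler_pM ?gbnd// normrM distrC normfV (ger0_norm (ltW h30)).
  by rewrite ler_piMr// invf_le1.
Qed.

End hilbert_transform.

(** * Non-vanishing of combinations of translates *)

Lemma integrableD_fin (R : realType) (f h : R -> R) (D : set R) : measurable D ->
  (@lebesgue_measure R).-integrable D (EFin \o f) ->
  (@lebesgue_measure R).-integrable D (EFin \o h) ->
  (@lebesgue_measure R).-integrable D (EFin \o (fun x => f x + h x)).
Proof.
move=> mD fi hi; rewrite (_ : _ \o _ = (EFin \o f) \+ (EFin \o h))%E.
  exact: integrableD.
by apply/funext => x /=; rewrite EFinD.
Qed.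

Lemma integrable_Rintegral_sum (R : realType) (J : Type) (r : seq J)
    (f : J -> R -> R) (D : set R) :
  measurable D ->
  (forall i, (@lebesgue_measure R).-integrable D (EFin \o f i)) ->
  (@lebesgue_measure R).-integrable D (EFin \o (fun x => \sum_(i <- r) f i x)) /\
  Rintegral (@lebesgue_measure R) D (fun x => \sum_(i <- r) f i x) =
  \sum_(i <- r) Rintegral (@lebesgue_measure R) D (f i).
Proof.
move=> mD fi; elim: r => [|i r [IHi IH]].
  have -> : (fun x : R => \sum_(i <- [::]) f i x) = (fun=> 0).
    by apply/funext => x; rewrite big_nil.
  rewrite big_nil; split; last by rewrite Rintegral_cst// mul0r.
  exact: integrable0.
have -> : (fun x : R => \sum_(j <- i :: r) f j x) =
          (fun x => f i x + \sum_(j <- r) f j x).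
  by apply/funext => x; rewrite big_cons.
rewrite big_cons; split; last by rewrite RintegralD ?IH.
exact: integrableD_fin.
Qed.

Lemma continuous_itv_integrable (R : realType) (a b : R) (f : R -> R) :
  (forall s, a <= s <= b -> {for s, continuous f}) ->
  (@lebesgue_measure R).-integrable `[a, b] (EFin \o f).
Proof.
move=> cf; apply: continuous_compact_integrable; first exact: segment_compact.
by apply: continuous_in_subspaceT => s; rewrite inE/= in_itv/=; exact: cf.
Qed.

(** * The zeroth and first moments of the derivative of the kernel *)

Section kernel_moments.
Variables (R : realType) (phi : R -> R) (A : R).
Notation mu := (@lebesgue_measure R).
Hypothesis A0 : 0 < A.
Hypothesis phi_supp : forall x, A <= `|x| -> phi x = 0.
Hypothesis dphi : forall x : R, derivable phi x 1.
Hypothesis cphi' : continuous (derive1 phi).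
Hypothesis phi1 : Rintegral mu setT phi = 1.

Let is_derive_phi (x : R) : is_derive x 1 phi (derive1 phi x).
Proof. by apply: DeriveDef; [exact: dphi|rewrite derive1E]. Qed.

Let cphi (x : R) : {for x, continuous phi}.
Proof. exact/differentiable_continuous/derivable1_diffP. Qed.

Let phiA : phi A = 0. Proof. by rewrite phi_supp// ger0_norm// ltW. Qed.
Let phiNA : phi (- A) = 0.
Proof. by rewrite phi_supp// normrN ger0_norm// ltW. Qed.

Lemma Rintegral_derive1_eq0 : Rintegral mu `[- A, A] (derive1 phi) = 0.
Proof.
transitivity (phi A - phi (- A)); last by rewrite phiA phiNA subrr.
apply: Rintegral_FTC2; first by have := A0; lra.
- by move=> x _; exact: cphi'.
- by move=> x _; exact: is_derive_phi.
Qed.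

Lemma Rintegral_id_derive1 :
  Rintegral mu `[- A, A] (fun s => s * derive1 phi s) = -1.
Proof.
have cid (x : R) : {for x, continuous (fun s : R => s * derive1 phi s)}.
  by apply: cvgM; [exact: cvg_id|exact: cphi'].
(* Integration by parts: the integrand is the derivative of [s * phi s], which vanishes at both
   ends, and [phi] has mass 1. *)
have : Rintegral mu `[- A, A] (fun s => s * derive1 phi s + phi s) = 0.
  transitivity (A * phi A - (- A) * phi (- A)); last by rewrite phiA phiNA !mulr0 subrr.
  apply: (@Rintegral_FTC2 _ _ (fun s => s * phi s)).
  - by have := A0; lra.
  - by move=> x _; apply: cvgD; [exact: cid|exact: cphi].
  - move=> x _; have := is_deriveM (is_derive_id x 1) (is_derive_phi x).
    by rewrite /GRing.scale/= mulr1.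
rewrite RintegralD//; [|exact: continuous_itv_integrable..].
have -> : Rintegral mu `[- A, A] phi = 1.
  rewrite -phi1 Rintegral_mkcond; apply: eq_Rintegral => s _.
  rewrite /patch; case: ifPn => //; rewrite notin_setE/= in_itv/= => /negP.
  by rewrite -ler_norml -ltNge => /ltW/phi_supp.
by move/eqP; rewrite addr_eq0 => /eqP.
Qed.

End kernel_moments.

Section translates.
Variables (R : realType) (g : R -> R) (A G : R).
Notation mu := (@lebesgue_measure R).
Hypothesis A0 : 0 < A.
Hypothesis cg : continuous g.
Hypothesis gsupp : forall x, A < `|x| -> g x = 0.
Hypothesis gbnd : forall x, `|g x| <= G.
Hypothesis g_int0 : Rintegral mu `[- A, A] g = 0.
Hypothesis g_int1 : Rintegral mu `[- A, A] (fun s => s * g s) = -1.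
Variables (K : nat) (theta b : 'I_K -> R) (beta : R).
Hypothesis bbeta : forall i, `|b i| <= beta.

(* Expand [theta i / (t - (s - b i))] in powers of [(s - b i) / t]: after summation
   over [i] and integration against [g], the minimal power sum at rank [N] pairs
   with [1] and contributes [0]; rank [N.+1] pairs with [s] and contributes the
   main term. *)
Lemma hilbert_translates_expansion (N : nat) (t : R) :
  (forall n, (n < N)%N -> \sum_i theta i * (- b i) ^+ n = 0) ->
  A + beta + 1 <= t ->
  `|t ^+ N.+2 * pi * (\sum_i theta i * hilbert g (t + b i)) +
    N.+1%:R * \sum_i theta i * (- b i) ^+ N|
  <= G * (\sum_i `|theta i|) * (A + beta) ^+ N.+2 / (t - A - beta) * (2 * A).
Proof.
move=> BN0 tA; have A_gt0 := A0.
set B := \sum_i theta i * (- b i) ^+ N.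
set B' := \sum_i theta i * (- b i) ^+ N.+1.
have bb i : - beta <= b i <= beta by rewrite -ler_norml.
have us i (s : R) : - A <= s <= A -> t - (s - b i) >= t - A - beta.
  by have := bb i => /andP[? ?] /andP[? ?]; lra.
have tb i : 1 <= t + b i - A by have := bb i => /andP[? ?]; lra.
(* The exact remainder of the geometric expansion after its [N.+2] first terms. *)
pose r i s := theta i * ((s - b i) ^+ N.+2 / (t - (s - b i))).
pose f i s := theta i * (t ^+ N.+2 * (g s / (t + b i - s))).
have cf i (s : R) : - A <= s <= A -> {for s, continuous (fun s : R => g s / (t + b i - s))}.
  move=> sA; apply: continuous_div_sub; first exact: cg.
  by have := us i s sA => usi; rewrite gt_eqF//; lra.
have intgf i : mu.-integrable `[- A, A] (EFin \o (fun s => g s / (t + b i - s))).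
  by apply: continuous_itv_integrable => s /cf.
have intf i : mu.-integrable `[- A, A] (EFin \o f i).
  apply: continuous_itv_integrable => s sA.
  by apply: cvgM; [exact: cvg_cst|apply: cvgM; [exact: cvg_cst|exact: cf]].
have ig : mu.-integrable `[- A, A] (EFin \o g).
  by apply: continuous_itv_integrable => s _; exact: cg.
have cig (s : R) : {for s, continuous (fun s : R => s * g s)}.
  by apply: cvgM; [exact: cvg_id|exact: cg].
have iig : mu.-integrable `[- A, A] (EFin \o (fun s => s * g s)).
  by apply: continuous_itv_integrable => s _.
have intE i : Rintegral mu `[- A, A] (f i) =
    t ^+ N.+2 * pi * (theta i * hilbert g (t + b i)).
  rewrite (hilbert_far gsupp); last by have := tb i => tbi; rewrite ger0_norm; lra.
  have itf : mu.-integrable `[- A, A]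
      (EFin \o (fun s => t ^+ N.+2 * (g s / (t + b i - s)))).
    apply: continuous_itv_integrable => s sA.
    by apply: cvgM; [exact: cvg_cst|exact: cf].
  rewrite /f RintegralZl// RintegralZl//.
  have pi0 : pi != 0 :> R by rewrite gt_eqF ?pi_gt0.
  by rewrite [RHS]mulrCA; congr (theta i * _); rewrite -[RHS]mulrA mulVKf.
have cr i (s : R) : - A <= s <= A -> {for s, continuous (fun s : R => g s * r i s)}.
  move=> sA; apply: cvgM; first exact: cg.
  apply: cvgM; first exact: cvg_cst.
  apply: cvgM.
    by apply: (@cvg_comp _ _ _ (fun s => s - b i) (fun x => x ^+ N.+2));
      [apply: cvgB; [exact: cvg_id|exact: cvg_cst]|exact: exprn_continuous].
  apply: cvgV; first by have := us i s sA => usi; rewrite gt_eqF//; lra.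
  by apply: cvgB; [exact: cvg_cst|apply: cvgB; [exact: cvg_id|exact: cvg_cst]].
have intr i : mu.-integrable `[- A, A] (EFin \o (fun s => g s * r i s)).
  by apply: continuous_itv_integrable => s; exact: cr.
have mA : measurable (`[- A, A] : set R) by [].
have [_ sumf] := integrable_Rintegral_sum (index_enum 'I_K) mA intf.
have [isumr sumr] := integrable_Rintegral_sum (index_enum 'I_K) mA intr.
have fE (s : R) : - A <= s <= A -> \sum_i f i s =
    (t * B + B') * g s + N.+1%:R * B * (s * g s) + \sum_i g s * r i s.
  move=> sA.
  have -> : \sum_i f i s =
      g s * \sum_i theta i * (t ^+ N.+2 / (t - (s - b i))).
    rewrite mulr_sumr; apply: eq_bigr => i _; rewrite /f.
    by rewrite (_ : t + b i - s = t - (s - b i)); ring.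
  under eq_bigr => i _.
    rewrite geometric_inv_sub; last by have := us i s sA => usi; rewrite gt_eqF//; lra.
    rewrite mulrDr; over.
  rewrite big_split/= mulrDr -[X in _ = _ + X]mulr_sumr; congr (_ + _).
  have -> : \sum_(i < K) theta i * (\sum_(n < N.+2) t ^+ (N.+1 - n) * (s - b i) ^+ n) =
      \sum_(n < N.+2) t ^+ (N.+1 - n) * \sum_(i < K) theta i * (s + - b i) ^+ n.
    under eq_bigr do rewrite mulr_sumr.
    rewrite exchange_big; apply: eq_bigr => n _ /=.
    by rewrite mulr_sumr; apply: eq_bigr => i _; rewrite mulrCA.
  (* Only ranks [N] and [N.+1] survive: a constant and an affine function of [s]. *)
  rewrite !big_ord_recr/= big1 ?add0r; last first.
    by move=> n _; rewrite (translated_power_sum_lt BN0)// mulr0.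
  rewrite (translated_power_sum_min BN0) (translated_power_sum_minS BN0).
  rewrite subnn subSnn expr0 expr1 mul1r -/B -/B'; ring.
have sumE : t ^+ N.+2 * pi * (\sum_i theta i * hilbert g (t + b i)) =
    - (N.+1%:R * B) + Rintegral mu `[- A, A] (fun s => \sum_i g s * r i s).
  rewrite mulr_sumr; under eq_bigr do rewrite -intE.
  rewrite -sumf.
  have ic1 : mu.-integrable `[- A, A] (EFin \o (fun s => (t * B + B') * g s)).
    apply: continuous_itv_integrable => s sA.
    by apply: cvgM; [exact: cvg_cst|exact: cg].
  have ic2 : mu.-integrable `[- A, A] (EFin \o (fun s => N.+1%:R * B * (s * g s))).
    apply: continuous_itv_integrable => s sA.
    by apply: cvgM; [exact: cvg_cst|exact: cig].
  have ic : mu.-integrable `[- A, A]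
      (EFin \o (fun s => (t * B + B') * g s + N.+1%:R * B * (s * g s))).
    exact: integrableD_fin.
  transitivity (Rintegral mu `[- A, A]
    (fun s => (t * B + B') * g s + N.+1%:R * B * (s * g s) + \sum_i g s * r i s)).
    by apply: eq_Rintegral => s; rewrite inE/= in_itv/= => /fE.
  rewrite RintegralD// RintegralD// RintegralZl// RintegralZl//.
  (* The coefficient [t * B + B'], which grows with [t], is annihilated by the zero mean of [g]; the
     first moment -1 yields the main term. *)
  by rewrite g_int0 g_int1 mulr0 add0r mulrN1.
rewrite sumE addrAC addNr add0r.
rewrite (_ : 2 * A = A - (- A)); last by ring.
have tAb : 0 < t - A - beta by lra.
have G0 : 0 <= G by exact: le_trans (normr_ge0 _) (gbnd 0).
(* The sign of [beta] is known only through some index [i], so the empty family is treated apart. *)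
have [K0|[i0 _]] : (forall i : 'I_K, False) \/ (exists i : 'I_K, True).
- by case: (K) => [|n]; [left => -[]|right; exists ord0].
- have z0 (h : 'I_K -> R) : \sum_i h i = 0 by apply: big1 => i; case: (K0 i).
  rewrite [X in G * X]z0 mulr0 !mul0r.
  have -> : (fun s => \sum_i g s * r i s) = (fun=> 0) by apply/funext => s; rewrite z0.
  by rewrite Rintegral_cst// mul0r normr0.
have beta0 : 0 <= beta := le_trans (normr_ge0 _) (bbeta i0).
apply: normr_Rintegral_le => //.
- by lra.
- by move/integrableP : isumr => [/measurable_EFinP].
- rewrite divr_ge0 ?(ltW tAb)// mulr_ge0 ?exprn_ge0 ?mulr_ge0 ?sumr_ge0//; lra.
- move=> s; rewrite /= in_itv/= => sA.
  rewrite -mulr_sumr normrM.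
  rewrite (_ : G * _ * _ / _ = G * ((\sum_i `|theta i|) *
    ((A + beta) ^+ N.+2 / (t - A - beta)))); last by rewrite !mulrA.
  rewrite ler_pM//.
  rewrite mulr_suml; apply: le_trans (ler_norm_sum _ _ _) _; apply: ler_sum => i _.
  rewrite /r normrM ler_wpM2l// normrM normfV normrX.
  have := us i s sA => usi.
  rewrite ler_pM ?invr_ge0 ?exprn_ge0//.
    rewrite lerXn2r ?nnegrE//; first by lra.
    by rewrite (le_trans (ler_normB _ _))// lerD// ler_norml.
  by rewrite lef_pV2 ?posrE ?normr_gt0 ?gt_eqF// ?ger0_norm//; lra.
Qed.

(** At the least rank [N] with a nonzero power sum, the expansion has a nonzero constant main term
    and a remainder of order [1 / t], so the main term wins for large [t]. *)
Lemma hilbert_translates_neq0 : injective b -> (exists i, theta i != 0) ->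
  exists T0 c0, [/\ 0 < c0, A + beta + 1 <= T0 &
    forall t, T0 <= t <= T0 + 1 -> c0 <= `|\sum_i theta i * hilbert g (t + b i)|].
Proof.
move=> injb thn0; have A_gt0 := A0.
have [|n0 Bn0] := @exists_power_sum_neq0 R K theta (fun i => - b i) _ thn0.
  by move=> i j /oppr_inj/injb.
have [N BN Nmin] := ex_minnP (ex_intro (fun n => \sum_i theta i * (- b i) ^+ n != 0) n0 Bn0).
have BN0 n : (n < N)%N -> \sum_i theta i * (- b i) ^+ n = 0.
  by move=> nN; apply/eqP; apply: contraTT nN => /Nmin; rewrite -leqNgt.
have [i0 _] := thn0.
have beta0 : 0 <= beta by exact: le_trans (normr_ge0 _) (bbeta i0).
have G0 : 0 <= G by exact: le_trans (normr_ge0 _) (gbnd 0).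
set B := \sum_i theta i * (- b i) ^+ N in BN.
pose H := G * (\sum_i `|theta i|) * (A + beta) ^+ N.+2 * (2 * A).
have s0 : 0 <= \sum_i `|theta i| by apply: sumr_ge0.
have Ab0 : 0 <= A + beta by lra.
have H0 : 0 <= H.
  apply: mulr_ge0; last by lra.
  by apply: mulr_ge0; [exact: mulr_ge0|exact: exprn_ge0].
pose m := N.+1%:R * `|B|.
have m0 : 0 < m by rewrite mulr_gt0// normr_gt0.
(* From [T0] on, the remainder [H / (t - A - beta)] is at most half of the main term [m]. *)
pose T0 := A + beta + 1 + H / (m / 2).
have q0 : 0 <= H / (m / 2) by rewrite divr_ge0//; lra.
have pi0 := pi_gt0 R.
have T01 : 0 < T0 + 1 by rewrite /T0; lra.
(* The remaining half is divided by the largest value of [pi * t ^+ N.+2] on the interval. *)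
exists T0, (m / 2 / (pi * (T0 + 1) ^+ N.+2)); split.
- by apply: divr_gt0; [lra|rewrite mulr_gt0// exprn_gt0].
- by rewrite /T0; lra.
move=> t /andP[t1 t2]; have t0 : 0 < t by rewrite /T0 in t1; lra.
have tA : A + beta + 1 <= t by rewrite /T0 in t1; lra.
have := hilbert_translates_expansion BN0 tA; rewrite -/B.
set F := \sum_i _ * hilbert _ _ => hF.
have rho : `|t ^+ N.+2 * pi * F + N.+1%:R * B| <= m / 2.
  apply: le_trans hF _.
  rewrite (_ : _ * (2 * A) = H / (t - A - beta)); last by rewrite /H; ring.
  rewrite ler_pdivrMr; last by lra.
  rewrite mulrC -ler_pdivrMr; last by lra.
  by rewrite /T0 in t1; lra.
have lowF : m / 2 <= t ^+ N.+2 * pi * `|F|.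
  have -> : t ^+ N.+2 * pi * `|F| = `|t ^+ N.+2 * pi * F|.
    by rewrite normrM ger0_norm// mulr_ge0 ?exprn_ge0// ltW.
  have mE : m = `|N.+1%:R * B| by rewrite normrM ger0_norm.
  have := lerB_normD (N.+1%:R * B) (t ^+ N.+2 * pi * F).
  by rewrite -mE [_ * B + _]addrC => h; lra.
rewrite ler_pdivrMr; last by rewrite mulr_gt0// exprn_gt0.
apply: le_trans lowF _; rewrite mulrC ler_wpM2l// mulrC ler_wpM2l ?(ltW pi0)//.
by rewrite lerXn2r// ?nnegrE; lra.
Qed.

End translates.

(** * Generic directions *)

Section lipschitz.
Variable R : realType.

Lemma lipschitz_derive1_bounded (f : R -> R) (B : R) :
  (forall x : R, derivable f x 1) -> (forall x, `|derive1 f x| <= B) ->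
  forall x y, `|f x - f y| <= B * `|x - y|.
Proof.
move=> df fB x y; wlog xy : x y / x <= y.
  move=> h; have [/h//|/ltW/h] := leP x y.
  by rewrite distrC (distrC y).
have cf (z : R) : {for z, continuous f} by exact/differentiable_continuous/derivable1_diffP.
have der (z : R) : is_derive z 1 f (derive1 f z).
  by apply: DeriveDef; [exact: df|rewrite derive1E].
have cxy : {within `[x, y], continuous f}.
  by apply: continuous_in_subspaceT => z _; exact: cf.
have [c _ fc] := @MVT_segment R f (derive1 f) x y xy (fun z _ => der z) cxy.
rewrite distrC fc normrM (distrC x); apply: ler_wpM2r => //; exact: fB.
Qed.

Lemma continuous_supp_bounded (f : R -> R) (A : R) : 0 < A -> continuous f ->
  (forall x, A < `|x| -> f x = 0) -> exists C, forall x, `|f x| <= C.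
Proof.
move=> A0 cf fA.
have NAA : - A <= A by lra.
have cnf : {within `[- A, A], continuous (fun x => `|f x|)}.
  by apply: continuous_in_subspaceT => z _; apply: cvg_norm; exact: cf.
have [c _ fc] := EVT_max NAA cnf.
exists `|f c| => x; have [xA|xA] := leP `|x| A; last by rewrite fA// normr0.
  by apply: fc; rewrite in_itv/= -ler_norml.
Qed.

(** The strict inequality defines an open set, so [f] vanishes in a whole neighbourhood of [x]. *)
Lemma derive1_supp (f : R -> R) (A : R) : (forall x, A < `|x| -> f x = 0) ->
  forall x, A < `|x| -> derive1 f x = 0.
Proof.
move=> fA x Ax; rewrite derive1E (@near_eq_derive _ _ _ f (cst 0)) ?derive_cst//.
near=> y; apply: fA; near: y.
by have /cvgr_gt := @norm_continuous _ _ x; apply.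
Unshelve. all: by end_near. Qed.

Lemma dir_dot_le (a : R) (x : R * R) : `|dir_dot a x| <= `|x.1| + `|x.2|.
Proof.
rewrite /dir_dot (le_trans (ler_normD _ _))// lerD// normrM ler_piMl//.
  exact: cos_max.
exact: sin_max.
Qed.

Lemma dir_dot_lipschitz (x : R * R) (a a' : R) :
  `|dir_dot a x - dir_dot a' x| <= (`|x.1| + `|x.2|) * `|a - a'|.
Proof.
rewrite mulrDl.
have -> : dir_dot a x - dir_dot a' x =
    x.1 * (cos a - cos a') + x.2 * (sin a - sin a').
  by rewrite /dir_dot; ring.
rewrite (le_trans (ler_normD _ _))// lerD// normrM ler_wpM2l//.
- rewrite -[leRHS]mul1r; apply: lipschitz_derive1_bounded => z.
    by have [] := is_derive_cos z.
  by rewrite derive1E derive_val normrN sin_max.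
- rewrite -[leRHS]mul1r; apply: lipschitz_derive1_bounded => z.
    by have [] := is_derive_sin z.
  by rewrite derive1E derive_val cos_max.
Qed.

End lipschitz.

Section generic_direction.
Variable R : realType.

(** Two unit directions at an angle strictly between 0 and [pi] have determinant [sin (y - x) > 0];
    a vector orthogonal to both is zero by Cramer's rule. *)
Lemma dir_dot_eq0_unique (u : R * R) (a b x y : R) : u != (0, 0) -> b - a <= pi ->
  a < x < b -> a < y < b -> dir_dot x u = 0 -> dir_dot y u = 0 -> x = y.
Proof.
move=> u0 ab; wlog xy : x y / x < y.
  move=> h hx hy ux uy; have [xy|yx|//] := ltgtP x y; first exact: h.
  by apply/esym/h.
move=> /andP[ax _] /andP[_ yb] ux uy; exfalso.
have sxy : 0 < sin (y - x) by apply: sin_gt0_pi; lra.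
have det : sin (y - x) = cos x * sin y - sin x * cos y.
  by rewrite sinD cosN sinN; ring.
rewrite /dir_dot in ux uy.
move/eqP: u0; apply; rewrite [u]surjective_pairing; congr pair.
- apply: (mulIf (lt0r_neq0 sxy)); rewrite mul0r det.
  transitivity (sin y * (cos x * u.1 + sin x * u.2) - sin x * (cos y * u.1 + sin y * u.2)).
    by ring.
  by rewrite ux uy !mulr0 subrr.
- apply: (mulIf (lt0r_neq0 sxy)); rewrite mul0r det.
  transitivity (cos x * (cos y * u.1 + sin y * u.2) - cos y * (cos x * u.1 + sin x * u.2)).
    by ring.
  by rewrite ux uy !mulr0 subrr.
Qed.

Lemma generic_direction (K : nat) (xs : 'I_K -> R * R) (z a b : R) :
  injective xs -> a < b ->
  exists2 x, a < x < b & x != z /\ injective (fun i => dir_dot x (xs i)).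
Proof.
move=> injxs ab.
pose b' := Num.min b (a + pi).
have ab' : a < b' by rewrite lt_min ab ltrDl pi_gt0.
have bpi : b' - a <= pi.
  by rewrite lerBlDl; rewrite ge_min lexx orbT.
(* One condition per pair of distinct points, each met by at most one angle since the interval was
   cut to length at most [pi]; [None] stands for the extra forbidden angle [z]. *)
pose Q (o : option ('I_K * 'I_K)) (x : R) :=
  if o is Some ij then ij.1 <> ij.2 /\ dir_dot x (xs ij.1) = dir_dot x (xs ij.2)
  else x = z.
have [] := @avoid_finType R (option ('I_K * 'I_K)) Q a b' ab'.
  move=> [[i j]|] x y hx hy /=; last by move=> -> ->.
  move=> [ij xij] [_ yij].
  apply: (@dir_dot_eq0_unique ((xs i).1 - (xs j).1, (xs i).2 - (xs j).2) a b') => //.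
  - apply/eqP => -[/subr0_eq e1 /subr0_eq e2]; apply: ij; apply: injxs.
    by rewrite [LHS]surjective_pairing e1 e2 -surjective_pairing.
  - move: xij => /eqP; rewrite -subr_eq0 => /eqP <-; rewrite /dir_dot /=; ring.
  - move: yij => /eqP; rewrite -subr_eq0 => /eqP <-; rewrite /dir_dot /=; ring.
move=> x /andP[ax xb'] nQ; exists x.
  by rewrite ax (lt_le_trans xb')// ge_min lexx.
split; first by apply/eqP; exact: (nQ None).
move=> i j xij; apply: contrapT => ij; exact: (nQ (Some (i, j))).
Qed.

(** [Om] lies in [0, 2 pi] whereas the indices cover [- pi, pi], so angles above [pi] are shifted by
    one period. Avoiding [pi] itself makes [|a| < pi] strict, which leaves room for a neighbourhood
    of [a] in the index range. *)
Lemma generic_direction_nondegenerate (K : nat) (xs : 'I_K -> R * R) (x0 : R * R)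
    (sigma : R -> R -> R) (Om : set R) : injective xs ->
  (forall a p, sigma (a + 2 * pi) p = sigma a p) ->
  open Om -> Om !=set0 -> Om `<=` `[0, 2 * pi]%classic ->
  (forall a, Om a -> sigma a (dir_dot a x0) ^+ 2 != 0) ->
  exists a, [/\ `|a| < pi, sigma a (dir_dot a x0) != 0 &
    injective (fun i => dir_dot a (xs i))].
Proof.
move=> injxs sper oOm [w Omw] Om2pi sOm.
have pi0 := pi_gt0 R.
have /nbhs_ballP[r /= r0 rOm] : nbhs w Om by exact: open_nbhs_nbhs.
have [|a /andP[wa aw] [api inja]] := @generic_direction K xs pi (w - r) (w + r) injxs.
  by rewrite -subr_gt0; lra.
have Oma : Om a by apply: rOm; rewrite /ball/= ltr_norml; lra.
have /= := Om2pi _ Oma; rewrite in_itv/= => /andP[a0 a2pi].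
have sa : sigma a (dir_dot a x0) != 0.
  by have := sOm _ Oma; rewrite expf_eq0.
have [alt|age] := ltP a pi; first by exists a; split => //; rewrite ger0_norm.
have agt : pi < a by rewrite lt_neqAle eq_sym api.
have dirE x : dir_dot (a - 2 * pi) x = dir_dot a x.
  have -> : a - 2 * pi = a - pi - pi by ring.
  rewrite /dir_dot -[in RHS](subrK pi a) -[a - pi in RHS](subrK pi (a - pi)).
  by rewrite !cosDpi !sinDpi !opprK.
exists (a - 2 * pi); split.
- by rewrite ltr_norml; lra.
- by rewrite dirE -(sper (a - 2 * pi)) subrK.
- by move=> i j; rewrite /= !dirE => /inja.
Qed.

End generic_direction.

(** * Lattice points and bounds on the kernel *)

Section lattice_counting.
Variable R : realType.

Lemma sumr_const_seq (I : Type) (s : seq I) (v : R) :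
  \sum_(i <- s) v = (size s)%:R * v.
Proof. by rewrite big_const_seq count_predT iter_addr_0 mulr_natl. Qed.

Lemma krange_size (h : R) (s : seq int) : 0 < h -> uniq s ->
  (forall k, k \in s -> `|k%:~R * h| <= pi) -> (size s)%:R <= 2 * pi / h + 1.
Proof.
move=> h0 us sk; have pih : 0 <= pi / h by rewrite divr_ge0 ?pi_ge0// ltW.
pose n := Num.truncn (pi / h).
have sn : {subset s <= int_range n}.
  move=> k /sk; rewrite normrM (gtr0_norm h0) -ler_pdivlMr// => kpi.
  apply: mem_int_range; rewrite truncn_ge_nat// (le_trans _ kpi)//.
  by rewrite -intr_norm -[X in _ <= X%:~R]abszE.
have : (size s <= n.*2.+1)%N.
  by have := uniq_leq_size us sn; rewrite size_map size_iota.
rewrite -(ler_nat R) => /le_trans; apply.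
rewrite -natr1 lerD2r -mul2n natrM -mulrA ler_wpM2l//.
by rewrite -truncn_ge_nat.
Qed.

Variables (D : set int) (F : int -> int -> \bar R) (a : int -> R).

Lemma esum_lattice_le (V n : R) : 0 <= V ->
  (forall s : seq int, uniq s -> (forall k, k \in s -> D k) -> (size s)%:R <= n) ->
  (forall k j, D k -> (F k j <= (V / (2 + `|a k - j%:~R|) ^+ 2)%:E)%E) ->
  (\esum_(k in D) \esum_(j in [set: int]) F k j <= (n * (2 * V))%:E)%E.
Proof.
move=> V0 sD FV.
apply: (@le_trans _ _ (\esum_(k in D) (2 * V)%:E)%E).
  apply: le_esum => k Dk.
  apply: (@le_trans _ _ (\esum_(j in [set: int])
      (V / (2 + `|a k - j%:~R|) ^+ 2)%:E)%E).
    by apply: le_esum => j _; exact: FV.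
  apply: esum_le_seq => s us _.
  by rewrite -mulr_sumr mulrC ler_wpM2r// lattice_sum_inv_sqr_le2.
apply: esum_le_seq => s us sk.
by rewrite sumr_const_seq ler_wpM2r ?sD// mulr_ge0.
Qed.

(** The sums are suprema over finite sets, so a single [j] for each [k] in [s] already gives a lower
    bound. *)
Lemma esum_lattice_ge (v : R) (s : seq int) : uniq s -> (forall k, k \in s -> D k) ->
  (forall k, k \in s -> exists j, (v%:E <= F k j)%E) ->
  (((size s)%:R * v)%:E <= \esum_(k in D) \esum_(j in [set: int]) F k j)%E.
Proof.
move=> us sD Fv; apply: (@le_esum_seq _ _ _ _ _ s) => //.
have -> : ((size s)%:R * v)%:E = (\sum_(k <- s) v%:E)%E.
  by rewrite sumEFin sumr_const_seq.
rewrite big_seq [leRHS]big_seq; apply: lee_sum => k /Fv[j vj].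
by apply: (@le_esum_seq _ _ _ _ _ [:: j]) => //; rewrite big_seq1.
Qed.

Lemma lattice_points_near (h a0 eta : R) : 0 < h -> 2 * h <= eta ->
  exists s : seq int, [/\ uniq s, forall k, k \in s -> `|k%:~R * h - a0| <= eta &
    eta / 2 <= (size s)%:R * h].
Proof.
move=> h0 heta.
have eta0 : 0 <= eta / h by rewrite divr_ge0//; lra.
(* Take [m] consecutive integers from the first one beyond [a0 / h]. The last stays within [eta / h]
   of it, and [m * h > eta - h >= eta / 2] because [2 * h <= eta]. *)
pose k0 := Num.floor (a0 / h) + 1.
pose m := Num.truncn (eta / h).
exists [seq k0 + i%:Z | i <- iota 0 m]; split.
- rewrite map_inj_uniq ?iota_uniq// => i j /addrI[].
  by [].
- move=> k /mapP[i]; rewrite mem_iota add0n => /andP[_ im] ->.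
  have im' : i%:R + 1 <= eta / h.
    by rewrite natr1 -truncn_ge_nat.
  have /andP[f1 f2] := floor_itv (a0 / h).
  have k0E : (k0 + i%:Z)%:~R = (Num.floor (a0 / h))%:~R + 1 + i%:R :> R.
    by rewrite /k0 !rmorphD/= -pmulrn.
  have i0 : 0 <= i%:R :> R by [].
  rewrite rmorphD/= rmorph1 in f2.
  have e : (k0 + i%:Z)%:~R * h - a0 = ((k0 + i%:Z)%:~R - a0 / h) * h.
    by rewrite mulrBl divfK// gt_eqF.
  rewrite e normrM (gtr0_norm h0) -ler_pdivlMr// k0E ger0_norm; lra.
- rewrite size_map size_iota.
  have := truncnS_gt (eta / h); rewrite -/m -natr1 ltr_pdivrMr// mulrDl mul1r.
  lra.
Qed.

End lattice_counting.

Lemma esum_esum_ge0 (R : realType) (D : set int) (F : int -> int -> \bar R) :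
  (forall k j, D k -> (0 <= F k j)%E) ->
  (0 <= \esum_(k in D) \esum_(j in [set: int]) F k j)%E.
Proof. by move=> F0; apply: esum_ge0 => k Dk; apply: esum_ge0 => j _; exact: F0. Qed.

Lemma powR32 (R : realType) (x : R) : 0 <= x -> x `^ (3 / 2) = x * Num.sqrt x.
Proof.
move=> x0; have [->|xn0] := eqVneq x 0; first by rewrite powR0 ?mul0r// gt_eqF.
have -> : 3 / 2 = 1 + 2^-1 :> R by field.
by rewrite powRD ?powRr1 ?powR12_sqrt// xn0 implybT.
Qed.

(** Every closed window of length 1 meets the lattice of points [x - j]; this selects the [j] kept
    in the lower bound of the denominator. *)
Lemma floor_sub_itv (R : realType) (x T : R) :
  T <= x - (Num.floor (x - T))%:~R <= T + 1.
Proof.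
have /andP[f1 f2] := floor_itv (x - T).
by rewrite rmorphD/= rmorph1 in f2; lra.
Qed.

(** * Decay and local non-vanishing of the combined kernel, in angle and position *)

Section kernel_bounds.
Variables (R : realType) (g : R -> R) (A G Lg : R).
Hypothesis A0 : 0 < A.
Hypothesis cg : continuous g.
Hypothesis gsupp : forall x, A < `|x| -> g x = 0.
Hypothesis gbnd : forall x, `|g x| <= G.
Hypothesis glip : forall x y, `|g x - g y| <= Lg * `|x - y|.
Variables (K : nat) (theta : 'I_K -> R) (xs : 'I_K -> R * R).

Let Sg a t := \sum_i theta i * hilbert g (t + dir_dot a (xs i)).

Let beta := \sum_i (`|(xs i).1| + `|(xs i).2|).

Let dir_beta a i : `|dir_dot a (xs i)| <= beta.
Proof.
apply: le_trans (dir_dot_le _ _) _; rewrite /beta (bigD1 i)//= lerDl.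
by apply: sumr_ge0 => j _; rewrite addr_ge0.
Qed.

Lemma hilbert_sum_decay : exists C, 0 <= C /\ forall a t, `|Sg a t| <= C / (2 + `|t|).
Proof.
have [C [C0 hC]] := hilbert_decay A0 cg gsupp gbnd glip.
have beta0 : 0 <= beta by apply: sumr_ge0 => i _; rewrite addr_ge0.
(* A shift by at most [beta] costs a factor [1 + beta]: [2 + |t| <= (1 + beta) * (2 + |t + b|)] when
   [|b| <= beta]. *)
exists ((\sum_i `|theta i|) * (C * (1 + beta))); split.
  by rewrite mulr_ge0 ?sumr_ge0// mulr_ge0// addr_ge0.
move=> a t; rewrite -mulrA mulr_suml.
apply: le_trans (ler_norm_sum _ _ _) _; apply: ler_sum => i _.
rewrite normrM ler_wpM2l//; apply: le_trans (hC _) _.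
rewrite -mulrA ler_wpM2l//.
have t0 := normr_ge0 t; have tb0 := normr_ge0 (t + dir_dot a (xs i)).
rewrite ler_pdivlMr; last by lra.
rewrite mulrC ler_pdivrMr; last by lra.
have tri : `|t| <= `|t + dir_dot a (xs i)| + beta.
  rewrite -lerBlDr; apply: (@le_trans _ _ (`|t| - `|dir_dot a (xs i)|)).
    by rewrite lerB.
  exact: lerB_normD.
by nra.
Qed.

(** The bound at [a0] comes from the translates. All arguments stay to the right of [A + 1], where
    the Hilbert transform is Lipschitz, so a small change of angle loses at most half of it. *)
Lemma hilbert_sum_neq0_near (a0 : R) :
  Rintegral lebesgue_measure `[- A, A] g = 0 ->
  Rintegral lebesgue_measure `[- A, A] (fun s => s * g s) = -1 ->
  (exists i, theta i != 0) -> injective (fun i => dir_dot a0 (xs i)) ->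
  exists T0 c0 r, [/\ 0 < c0, 0 < r, 0 <= T0 & forall a t, `|a - a0| <= r ->
    T0 <= t <= T0 + 1 -> c0 <= `|Sg a t|].
Proof.
move=> g0 g1 thn0 inja; have A_gt0 := A0.
have [T0 [c0 [c00 AT0 hc]]] :=
  hilbert_translates_neq0 A0 cg gsupp gbnd g0 g1 (dir_beta a0) inja thn0.
have G0 : 0 <= G := le_trans (normr_ge0 _) (gbnd 0).
have beta0 : 0 <= beta by apply: sumr_ge0 => i _; rewrite addr_ge0.
have [L L0 hL] : exists2 L, 0 <= L & forall t t', A + 1 <= t -> A + 1 <= t' ->
    `|hilbert g t - hilbert g t'| <= L * `|t - t'|.
  exists (pi^-1 * (G * (2 * A))).
    by rewrite mulr_ge0 ?invr_ge0 ?pi_ge0// mulr_ge0// mulr_ge0// ltW.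
  by move=> t t' At At'; exact: (hilbert_far_lipschitz A0 cg gsupp gbnd).
pose W := \sum_i `|theta i| * (L * (`|(xs i).1| + `|(xs i).2|)).
have W0 : 0 <= W.
  by apply: sumr_ge0 => i _; rewrite mulr_ge0// mulr_ge0// addr_ge0.
(* [W] is the Lipschitz constant in the angle; [W + 1] keeps the quotient meaningful when
   [W = 0]. *)
exists T0, (c0 / 2), (c0 / (2 * (W + 1))); split.
- by lra.
- by rewrite divr_gt0// mulr_gt0//; lra.
- by lra.
move=> a t ar tT.
have far a' i : A + 1 <= t + dir_dot a' (xs i).
  have := dir_beta a' i; rewrite ler_norml => /andP[h1 h2].
  by move: tT => /andP[h3 h4]; lra.
have diff : `|Sg a t - Sg a0 t| <= W * `|a - a0|.
  rewrite /Sg -sumrB mulr_suml; apply: le_trans (ler_norm_sum _ _ _) _.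
  apply: ler_sum => i _; rewrite -mulrBr normrM -!mulrA ler_wpM2l//.
  apply: le_trans (hL _ _ (far a i) (far a0 i)) _; rewrite ler_wpM2l//.
  have -> : t + dir_dot a (xs i) - (t + dir_dot a0 (xs i)) =
            dir_dot a (xs i) - dir_dot a0 (xs i) by ring.
  exact: dir_dot_lipschitz.
have small : W * `|a - a0| <= c0 / 2.
  apply: (@le_trans _ _ ((W + 1) * (c0 / (2 * (W + 1))))).
    by apply: ler_pM => //; lra.
  by rewrite le_eqVlt; apply/orP; left; apply/eqP; field; rewrite gt_eqF//; lra.
move: diff (hc t tT); rewrite -/(Sg a0 t).
move: (Sg a t) (Sg a0 t) => u v diff hv.
by have := lerB_dist v (v - u); rewrite subKr (distrC v); lra.
Qed.

End kernel_bounds.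

(** The mean value theorem is applied in each variable separately. The window for [p] is centred at
    [dir_dot a x0], moving with [a], because the selected [p_j] follow [alpha_k]. *)
Lemma sigma_sqr_near (R : realType) (sigma : R -> R -> R) (x0 : R * R) (B a0 : R) :
  (forall a p, derivable (fun a' => sigma a' p) a 1) ->
  (forall a p, derivable (fun p' => sigma a p') p 1) ->
  (forall a p, `|partial1 sigma a p| <= B /\ `|partial2 sigma a p| <= B) ->
  sigma a0 (dir_dot a0 x0) != 0 ->
  exists s0 r, [/\ 0 < s0, 0 < r & forall a p, `|a - a0| <= r ->
    `|p - dir_dot a x0| <= r -> s0 <= sigma a p ^+ 2].
Proof.
move=> d1 d2 dB sn0; set w := sigma a0 (dir_dot a0 x0) in sn0.
have B0 : 0 <= B by have [h _] := dB 0 0; exact: le_trans (normr_ge0 _) h.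
pose Q := `|x0.1| + `|x0.2|.
have Q0 : 0 <= Q by rewrite addr_ge0.
have w0 : 0 < `|w| by rewrite normr_gt0.
(* The total variation is at most [B * r + B * (r + Q * r)], hence at most half of [|w|]; the
   summand 1 covers [B = 0]. *)
pose r := `|w| / (2 * (B * (2 + Q) + 1)).
have den : 0 < B * (2 + Q) + 1 by rewrite ltr_wpDl// mulr_ge0// addr_ge0.
have r0 : 0 < r by rewrite divr_gt0// mulr_gt0.
exists ((`|w| / 2) ^+ 2), r; split => //; first by rewrite exprn_gt0// divr_gt0.
move=> a p ar pr.
have h1 : `|sigma a p - sigma a0 p| <= B * `|a - a0|.
  apply: (@lipschitz_derive1_bounded R (fun a' => sigma a' p)) => z.
    exact: d1.
  by have [] := dB z p.
have h2 : `|sigma a0 p - w| <= B * `|p - dir_dot a0 x0|.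
  apply: (@lipschitz_derive1_bounded R (fun p' => sigma a0 p')) => z.
    exact: d2.
  by have [] := dB a0 z.
have h3 : `|p - dir_dot a0 x0| <= r + Q * r.
  have -> : p - dir_dot a0 x0 = (p - dir_dot a x0) + (dir_dot a x0 - dir_dot a0 x0).
    by ring.
  rewrite (le_trans (ler_normD _ _))// lerD//.
  by rewrite (le_trans (dir_dot_lipschitz _ _ _))// ler_wpM2l.
have h4 : `|sigma a p - w| <= `|w| / 2.
  have -> : sigma a p - w = (sigma a p - sigma a0 p) + (sigma a0 p - w) by ring.
  apply: le_trans (ler_normD _ _) _; apply: (@le_trans _ _ (B * r + B * (r + Q * r))).
    by rewrite lerD// ?(le_trans h1) ?(le_trans h2)// ler_wpM2l.
  have -> : B * r + B * (r + Q * r) = (B * (2 + Q)) * r by ring.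
  apply: (@le_trans _ _ ((B * (2 + Q) + 1) * r)).
    by rewrite ler_wpM2r ?(ltW r0)// lerDl.
  by rewrite /r le_eqVlt; apply/orP; left; apply/eqP; field; rewrite gt_eqF.
have h5 : `|w| / 2 <= `|sigma a p|.
  by have := lerB_dist w (w - sigma a p); rewrite subKr (distrC w); lra.
rewrite -[leRHS]real_normK ?num_real//.
by rewrite lerXn2r// ?nnegrE// divr_ge0.
Qed.

(** * Estimate of the ratio of third to second moments *)

Unset Implicit Arguments.

(** The sums live in the extended reals; positivity of [D] and finiteness of both sums belong to the
    conclusion, so that [fine] and the quotient carry no default values. Each [e] has its own
    probability space. *)
Theorem theorem2 (R : realType) (kappa pbar : R) (x0 : R * R)
  (K : nat) (xs : 'I_K -> R * R) (theta : 'I_K -> R)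
  (sigma : R -> R -> R) (phi : R -> R) (M : nat) (nu c : R)
  (d : measure_display) (T : R -> measurableType d)
  (P : forall e : R, probability (T e) R)
  (eta : forall e : R, int -> int -> T e -> R) :
  0 < kappa ->
  (* the points and the weights *)
  (0 < K)%N -> injective xs -> (exists i, theta i != 0) ->
  (* sigma: 2pi-periodic in alpha, C^1, bounded with bounded first partials *)
  (forall a p, sigma (a + 2 * pi) p = sigma a p) ->
  (forall a p, derivable (fun a' => sigma a' p) a 1) ->
  (forall a p, derivable (fun p' => sigma a p') p 1) ->
  continuous (fun z : R * R => partial1 sigma z.1 z.2) ->
  continuous (fun z : R * R => partial2 sigma z.1 z.2) ->
  (exists B : R, forall a p, `|sigma a p| <= B /\ `|partial1 sigma a p| <= B
                             /\ `|partial2 sigma a p| <= B) ->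
  (* noise: independent real random variables, for each eps > 0 *)
  (forall e, 0 < e -> forall k j, measurable_fun setT (eta e k j)) ->
  (forall e, 0 < e -> mutual_indep (P e) [set kj : int * int | krange kappa e kj.1]
                        (fun kj => eta e kj.1 kj.2)) ->
  (* (N1) *)
  (forall e, 0 < e -> forall k j, krange kappa e k ->
     ('E_(P e)[eta e k j] = 0)%E) ->
  (* (N2) *)
  (forall e, 0 < e -> forall k j, krange kappa e k ->
     'E_(P e)[fun w => (eta e k j w ^+ 2)%R]
       = ((sigma (alpha_k kappa e k) (p_j pbar e j)) ^+ 2 * (kappa * e))%:E) ->
  (* (N3) *)
  (forall e, 0 < e -> forall k j, krange kappa e k ->
     ('E_(P e)[fun w => (`|eta e k j w| ^+ 3)%R]
       <= (c * (kappa * e) `^ (3 / 2))%:E)%E) ->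
  (* (K1) *)
  (exists A : R, forall x, A < `|x| -> phi x = 0) ->
  (* (K2): phi^(M) exists and is Lipschitz, i.e. phi^(M+1) in L^infty, M >= 3 *)
  (3 <= M)%N ->
  (forall n x, (n < M)%N -> derivable (derive1n n phi) x 1) ->
  (exists L : R, forall x y,
      `|derive1n M phi x - derive1n M phi y| <= L * `|x - y|) ->
  (* (K3) *)
  Rintegral lebesgue_measure setT phi = 1 ->
  (* (X1), with M > nu + 1 *)
  0 < nu -> of_type (kappa * norm2 x0) nu -> nu + 1 < M%:R ->
  (* (X2) *)
  (exists Om : set R, open Om /\ Om !=set0 /\ Om `<=` `[0, 2 * pi]%classic /\
      forall a, Om a -> sigma a (dir_dot a x0) ^+ 2 != 0) ->
  (* conclusion: ratio = O(eps^(1/2)) as eps -> 0+ *)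
  exists C delta : R, 0 < delta /\
    forall e, 0 < e -> e < delta ->
      let S := Hsum xs theta phi kappa pbar e x0 in
      let N := (\esum_(k in krange kappa e) \esum_(j in [set: int])
                  (`|S k j| ^+ 3)%:E * 'E_(P e)[fun w => (`|eta e k j w| ^+ 3)%R])%E in
      let D := (\esum_(k in krange kappa e) \esum_(j in [set: int])
                  ((S k j) ^+ 2)%:E * 'E_(P e)[fun w => (eta e k j w ^+ 2)%R])%E in
      (0 < D)%E /\ (D < +oo)%E /\ (N < +oo)%E /\
      fine N / (fine D) `^ (3 / 2) <= C * Num.sqrt e.
Proof.
move=> kappa0 _ injxs thn0 sper ds1 ds2 _ _ [B sB] _ _ _ EN2 EN3 [A1 phiA1] M3 dphi _
  phi1 _ _ _ [Om [oOm [Om0 [Om2pi sOm]]]].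
have pi0 := pi_gt0 R.
have B0 : 0 <= B by have [h _] := sB 0 0; exact: le_trans (normr_ge0 _) h.
(* Enlarging the radius makes it positive and lets [phi] vanish at the endpoints as well. *)
pose A := `|A1| + 1.
have A0 : 0 < A by rewrite ltr_wpDl.
have phiA x : A <= `|x| -> phi x = 0.
  by move=> Ax; apply: phiA1; have := ler_norm A1; rewrite /A in Ax; lra.
pose g := derive1 phi.
have dphi0 (x : R) : derivable phi x 1 by apply: (dphi 0%N); exact: leq_trans M3.
have dg (x : R) : derivable g x 1 by apply: (dphi 1%N); exact: leq_trans M3.
have dg' (x : R) : derivable (derive1 g) x 1 by apply: (dphi 2%N); exact: leq_trans M3.
have cg : continuous g by move=> x; exact/differentiable_continuous/derivable1_diffP.
have cg' : continuous (derive1 g).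
  by move=> x; exact/differentiable_continuous/derivable1_diffP.
have gA x : A < `|x| -> g x = 0.
  by apply: derive1_supp => y /ltW; exact: phiA.
have [G gG] := continuous_supp_bounded A0 cg gA.
have [Lg gLg] := continuous_supp_bounded A0 cg' (derive1_supp gA).
have glip := lipschitz_derive1_bounded dg gLg.
have g0 := Rintegral_derive1_eq0 A0 phiA dphi0 cg.
have g1 := Rintegral_id_derive1 A0 phiA dphi0 cg phi1.
have [Cs [Cs0 hCs]] := hilbert_sum_decay A0 cg gA gG glip theta xs.
have [a0 [a0pi sa0 inja0]] :=
  generic_direction_nondegenerate (x0 := x0) injxs sper oOm Om0 Om2pi sOm.
have [T0 [c0 [r1 [c00 r10 T00 hlow]]]] :=
  hilbert_sum_neq0_near A0 cg gA gG g0 g1 thn0 inja0.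
have dB a p : `|partial1 sigma a p| <= B /\ `|partial2 sigma a p| <= B.
  by have [_ []] := sB a p.
have [s0 [r2 [s00 r20 hsig]]] := sigma_sqr_near ds1 ds2 dB sa0.
(* Within this distance of [a0] the kernel sum and [sigma] are bounded below, and the angles stay in
   the index range. *)
pose eta0 := Num.min (Num.min r1 r2) (pi - `|a0|).
have eta00 : 0 < eta0 by rewrite !lt_min r10 r20 subr_gt0 a0pi.
have eta_r1 : eta0 <= r1 by rewrite /eta0 !ge_min lexx.
have eta_r2 : eta0 <= r2 by rewrite /eta0 !ge_min lexx orbT.
have eta_pi : eta0 <= pi - `|a0| by rewrite /eta0 !ge_min lexx orbT.
(* The number of good indices times [h] is at least [eta0 / 2]; each contributes at least
   [c0 ^+ 2 * s0 * h]. *)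
pose D0 := eta0 / 2 * (c0 ^+ 2 * s0).
have D00 : 0 < D0 by rewrite mulr_gt0 ?mulr_gt0 ?exprn_gt0// divr_gt0.
pose C := (2 * pi + 1) * (2 * (Cs ^+ 3 * `|c|)) * Num.sqrt kappa / D0 `^ (3 / 2).
(* For [e < delta]: [h < 1] absorbs the additive 1 in the index count, [2 * h < eta0] provides
   enough indices, and [(T0 + 1) * e < r2] keeps [p_j] close to [alpha_k . x0]. *)
pose delta := Num.min (Num.min 1 (eta0 / 2) / kappa) (r2 / (T0 + 1)).
have T01 : 0 < T0 + 1 by rewrite ltr_wpDl.
exists C, delta; split.
  by rewrite lt_min !divr_gt0// lt_min ltr01 divr_gt0.
move=> e e0; rewrite lt_min ltr_pdivlMr// lt_min.
rewrite ![e * kappa]mulrC => /andP[/andP[h1 h2] h3] S N D.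
set h := kappa * e in h1 h2.
have h0 : 0 < h by rewrite mulr_gt0.
pose ak := a_k kappa pbar e x0.
have SE k j : S k j = \sum_(i < K) theta i *
    hilbert g ((ak k - j%:~R) + dir_dot (alpha_k kappa e k) (xs i)) by [].
have Sle k j : `|S k j| <= Cs / (2 + `|ak k - j%:~R|) by rewrite SE; exact: hCs.
have den k j : 1 <= 2 + `|ak k - j%:~R| by rewrite -[leLHS]addr0 lerD// ler1n.
have ksize (s : seq int) : uniq s -> (forall k, k \in s -> krange kappa e k) ->
    (size s)%:R <= 2 * pi / h + 1 by exact: krange_size.
have EN2' k j : krange kappa e k ->
    (((S k j) ^+ 2)%:E * 'E_(P e)[fun w => (eta e k j w ^+ 2)%R] =
    (S k j ^+ 2 * (sigma (alpha_k kappa e k) (p_j pbar e j) ^+ 2 * h))%:E)%E.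
  by move=> kr; rewrite EN2.
have D_ge : (D0%:E <= D)%E.
  have heta : 2 * h <= eta0 by rewrite mulrC -ler_pdivlMr// ltW.
  have [s [us sa sm]] := lattice_points_near a0 h0 heta.
  have skr k : k \in s -> krange kappa e k.
    move=> /sa ka; rewrite /krange /= -/h.
    rewrite -(subrK a0 (_ * h)) (le_trans (ler_normD _ _))// -lerBrDr.
    exact: le_trans ka eta_pi.
  apply: (@le_trans _ _ (((size s)%:R * (c0 ^+ 2 * (s0 * h)))%:E)%E).
    rewrite lee_fin /D0.
    have -> : (size s)%:R * (c0 ^+ 2 * (s0 * h)) = (size s)%:R * h * (c0 ^+ 2 * s0).
      by ring.
    by rewrite ler_wpM2r// mulr_ge0 ?exprn_ge0// ltW.
  apply: esum_lattice_ge => // k ks.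
  exists (Num.floor (ak k - T0)); set j := Num.floor _.
  rewrite (EN2' k j (skr k ks)) lee_fin.
  have /andP[j1 j2] : T0 <= ak k - j%:~R <= T0 + 1 by exact: floor_sub_itv.
  have ka := sa _ ks.
  have Sc : c0 ^+ 2 <= S k j ^+ 2.
    rewrite -[leRHS]real_normK ?num_real//.
    rewrite lerXn2r// ?nnegrE ?(ltW c00)// SE; apply: hlow.
      exact: le_trans ka _.
    by rewrite j1.
  apply: ler_pM; [by rewrite exprn_ge0// ltW|by rewrite mulr_ge0// ltW|exact: Sc|].
  rewrite ler_wpM2r ?(ltW h0)//; apply: hsig; first exact: le_trans ka _.
  (* Bounded [a_k - j] thus means that [p_j] is within O([e]) of the projection of [x0]. *)
  have -> : p_j pbar e j - dir_dot (alpha_k kappa e k) x0 = - ((ak k - j%:~R) * e).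
    by rewrite /p_j /ak /a_k; field; rewrite gt_eqF.
  rewrite normrN normrM (gtr0_norm e0) (ger0_norm (le_trans T00 j1)).
  rewrite ltr_pdivlMr// in h3.
  apply: (@le_trans _ _ ((T0 + 1) * e)); first by rewrite ler_wpM2r// ltW.
  by rewrite mulrC ltW.
(* This gives finiteness of [D], which the passage from [D_ge] to [fine D] requires. *)
have D_le : (D <= ((2 * pi / h + 1) * (2 * (Cs ^+ 2 * (B ^+ 2 * h))))%:E)%E.
  apply: (@esum_lattice_le _ _ _ ak) => //.
    by rewrite mulr_ge0 ?exprn_ge0// mulr_ge0 ?exprn_ge0// ltW.
  move=> k j kr; rewrite EN2'// lee_fin.
  rewrite [leRHS]mulrAC; apply: ler_pM.
  - exact: sqr_ge0.
  - by rewrite mulr_ge0 ?sqr_ge0// ltW.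
  - rewrite -expr_div_n -[leLHS]real_normK ?num_real// lerXn2r ?nnegrE//.
    by rewrite divr_ge0// (le_trans ler01).
  - rewrite ler_wpM2r ?(ltW h0)// -[leLHS]real_normK ?num_real// lerXn2r ?nnegrE//.
    by have [] := sB (alpha_k kappa e k) (p_j pbar e j).
have h32 : h `^ (3 / 2) = h * Num.sqrt h by rewrite powR32// ltW.
pose V := Cs ^+ 3 * (`|c| * (h * Num.sqrt h)).
have V0 : 0 <= V.
  by rewrite mulr_ge0 ?exprn_ge0// mulr_ge0// mulr_ge0 ?sqrtr_ge0// ltW.
have En k j : (0 <= 'E_(P e)[fun w => (`|eta e k j w| ^+ 3)%R])%E.
  by apply: expectation_ge0 => w; exact: exprn_ge0.
have N_le : (N <= ((2 * pi / h + 1) * (2 * V))%:E)%E.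
  apply: (@esum_lattice_le _ _ _ ak) => // k j kr.
  apply: (@le_trans _ _ ((`|S k j| ^+ 3)%:E * (`|c| * (h * Num.sqrt h))%:E)%E).
    apply: lee_wpmul2l; first by rewrite lee_fin exprn_ge0.
    apply: le_trans (EN3 e e0 k j kr) _; rewrite -/h h32 lee_fin.
    by rewrite ler_wpM2r ?ler_norm// mulr_ge0 ?sqrtr_ge0// ltW.
  rewrite -EFinM lee_fin /V [leRHS]mulrAC; apply: ler_wpM2r.
    by rewrite mulr_ge0// mulr_ge0 ?sqrtr_ge0// ltW.
  apply: (@le_trans _ _ ((Cs / (2 + `|ak k - j%:~R|)) ^+ 3)).
    by rewrite lerXn2r// ?nnegrE// divr_ge0// (le_trans ler01).
  (* The cubic decay is weakened to the quadratic one, as the base is at least 1. *)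
  rewrite expr_div_n ler_wpM2l ?exprn_ge0//.
  rewrite lef_pV2 ?posrE ?exprn_gt0// ?(lt_le_trans ltr01)//.
  by rewrite exprS ler_peMl// exprn_ge0// (le_trans ler01).
have N_ge0 : (0 <= N)%E.
  by apply: esum_esum_ge0 => k j _; rewrite mule_ge0// lee_fin exprn_ge0.
have D_lt : (D < +oo)%E by rewrite (le_lt_trans D_le)// ltry.
have N_lt : (N < +oo)%E by rewrite (le_lt_trans N_le)// ltry.
have D_gt : (0 < D)%E by rewrite (lt_le_trans _ D_ge)// lte_fin.
split; [exact: D_gt|split; [exact: D_lt|split; [exact: N_lt|]]].
have fD : D0 <= fine D by rewrite -lee_fin fineK// ge0_fin_numE// ltW.
have fN : fine N <= (2 * pi + 1) * (2 * (Cs ^+ 3 * `|c|)) * Num.sqrt kappa * Num.sqrt e.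
  apply: (@le_trans _ _ ((2 * pi / h + 1) * (2 * V))).
    by rewrite -lee_fin fineK// ge0_fin_numE.
  (* The factor [1 / h] from counting indices cancels the [h] of [h * sqrt h], leaving
     [sqrt h = sqrt kappa * sqrt e]. *)
  have -> : (2 * pi + 1) * (2 * (Cs ^+ 3 * `|c|)) * Num.sqrt kappa * Num.sqrt e =
      ((2 * pi + 1) / h) * (2 * V).
    rewrite -mulrA -sqrtrM; last exact: ltW.
    by rewrite -/h /V; field; rewrite gt_eqF.
  apply: ler_wpM2r; first by rewrite mulr_ge0.
  by rewrite [leRHS]mulrDl lerD2l ler_pdivlMr// mul1r ltW.
rewrite /C mulrAC; apply: ler_pM.
- exact: fine_ge0.
- by rewrite invr_ge0 powR_ge0.
- exact: fN.
- have fD0 : 0 < fine D := lt_le_trans D00 fD.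
  rewrite lef_pV2 ?posrE ?powR_gt0//.
  have q32 : 0 <= 3 / 2 :> R by rewrite divr_ge0.
  by apply: (ge0_ler_powR q32 _ _ fD); rewrite nnegrE ltW.
Qed.
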